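(* Consider the problem of minimizing $f(x)=\sum_{i=1}^Nf^{[i]}(x)$ subject to $g(x)\le0$, $h(x)=0$, $x\in X$ (all local constraint sets equal to $X$), under the Slater condition. Let the non-degeneracy, balanced communication and periodic strong connectivity assumptions hold, and let the step-sizes satisfy the step-size assumption. Then for the sequences $\{x^{[i]}(k)\}$, $\{y^{[i]}(k)\}$ of the DPPDS algorithm there exists a primal optimal solution $\tilde x\in X^*$ such that $\lim_{k\to\infty}\|x^{[i]}(k)-\tilde x\|=0$ for all $i\in V$, and $\lim_{k\to\infty}|y^{[i]}(k)-p^*|=0$ for all $i\in V$.
   Context: Agents $V=\{1,\dots,N\}$; $f^{[i]}:\mathbb{R}^n\to\mathbb{R}$ convex; $X\subseteq\mathbb{R}^n$ nonempty compact convex; $g:\mathbb{R}^n\to\mathbb{R}^m$ with convex components; $h(x)=Ax-b$, $h_\ell(x)=a_\ell^Tx-b_\ell$, $\ell=1,\dots,\nu$; feasible set nonempty, $p^*$ optimal value, $X^*$ optimal set. Slater: exists $\bar x\in X$ with $g(\bar x)<0$, $h(\bar x)=0$, and a relative interior point $\tilde x$ of $X$ with $h(\tilde x)=0$. Network weights $a^i_j(k)\ge0$, $E(k)=\{(j,i):j\ne i,a^i_j(k)>0\}$; non-degeneracy: some $\eta>0$ with $a^i_i(k)\ge\eta$, $a^i_j(k)\in\{0\}\cup[\eta,1]$ for $i\neq j$; balanced: $\sum_ja^i_j(k)=1$, $\sum_ia^i_j(k)=1$; periodic strong connectivity: some integer $B\ge1$ with $(V,\bigcup_{k=0}^{B-1}E(k_0+k))$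 strongly connected for all $k_0$. Step-size assumption: $\alpha(k)>0$, $s(k):=\sum_{\ell=0}^k\alpha(\ell)$, $\alpha(k)\to0$, $\sum\alpha(k)=\infty$, $\sum\alpha(k)^2<\infty$, $\alpha(k+1)s(k)\to0$, $\sum_k\alpha(k+1)^2s(k)<\infty$, $\sum_k\alpha(k+1)^2s(k)^2<\infty$. DPPDS algorithm: $x^{[i]}(0)\in X$, $\mu^{[i]}(0)\in\mathbb{R}^m_{\ge0}$, $\lambda^{[i]}(0)\in\mathbb{R}^\nu_{\ge0}$, $y^{[i]}(1)=Nf^{[i]}(x^{[i]}(0))$; for $k\ge0$, $v^{[i]}_z(k)=\sum_ja^i_j(k)z^{[j]}(k)$ for $z\in\{x,y,\mu,\lambda\}$; $x^{[i]}(k+1)=P_X[v^{[i]}_x(k)-\alpha(k)\mathcal{S}^{[i]}_x(k)]$; $\mu^{[i]}(k+1)=v^{[i]}_\mu(k)+\alpha(k)[g(v^{[i]}_x(k))]^+$; $\lambda^{[i]}(k+1)=v^{[i]}_\lambda(k)+\alpha(k)|h(v^{[i]}_x(k))|$; for $k\ge1$, $y^{[i]}(k+1)=v^{[i]}_y(k)+N(f^{[i]}(x^{[i]}(k))-f^{[i]}(x^{[i]}(k-1)))$. Here $P_X$ is Euclidean projection, $[\cdot]^+$ componentwise positive part, $|\cdot|$ componentwise absolute value, and $\mathcal{S}^{[i]}_x(k)=\mathcal{D}f^{[i]}(v^{[i]}_x(k))+\sum_{\ell=1}^mv^{[i]}_\mu(k)_\ell\,\mathcal{D}[g_\ell]^+(v^{[i]}_x(k))+\sum_{\ell=1}^\nu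 v^{[i]}_\lambda(k)_\ell\,\mathcal{D}|h_\ell|(v^{[i]}_x(k))$, where $\mathcal{D}F(z)$ denotes a subgradient of the convex function $F$ at $z$. *)

(* Defs.v *)
From Stdlib Require Import Reals Relations.
From mathcomp Require Import ssreflect ssrfun ssrbool eqtype ssrnat seq fintype bigop.

Set Implicit Arguments.
Unset Strict Implicit.

Local Open Scope R_scope.

Definition vec (n : nat) := 'I_n -> R.

Definition sumI (n : nat) (F : 'I_n -> R) : R := \big[Rplus/R0]_(i < n) F i.

Definition vadd n (u v : vec n) : vec n := fun l => u l + v l.
Definition vsub n (u v : vec n) : vec n := fun l => u l - v l.
Definition vscale n (c : R) (u : vec n) : vec n := fun l => c * u l.
Definition vsum n N (F : 'I_N -> vec n) : vec n := fun l => sumI (fun j => F j l).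
Definition dot n (u v : vec n) : R := sumI (fun l => u l * v l).
Definition vnorm n (u : vec n) : R := sqrt (dot u u).

Definition convex_fun n (F : vec n -> R) : Prop :=
  forall x y t, 0 <= t <= 1 ->
    F (vadd (vscale t x) (vscale (1 - t) y)) <= t * F x + (1 - t) * F y.

Definition convex_set n (X : vec n -> Prop) : Prop :=
  forall x y t, X x -> X y -> 0 <= t <= 1 -> X (vadd (vscale t x) (vscale (1 - t) y)).

Definition compact_set n (X : vec n -> Prop) : Prop :=
  forall u : nat -> vec n, (forall k, X (u k)) ->
    exists (phi : nat -> nat) (x : vec n),
      (forall k, (phi k < phi k.+1)%nat) /\ X x /\
      Un_cv (fun k => vnorm (vsub (u (phi k)) x)) 0.

Fixpoint aff_comb n (l : list (R * vec n)) : vec n :=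
  match l with
  | nil => fun _ => 0
  | cons (c, p) l' => vadd (vscale c p) (aff_comb l')
  end.

Fixpoint coef_sum n (l : list (R * vec n)) : R :=
  match l with
  | nil => 0
  | cons (c, _) l' => c + coef_sum l'
  end.

Definition aff_hull n (X : vec n -> Prop) (y : vec n) : Prop :=
  exists l : list (R * vec n),
    List.Forall (fun p => X (snd p)) l /\ coef_sum l = 1 /\ y = aff_comb l.

Definition rel_interior n (X : vec n -> Prop) (x : vec n) : Prop :=
  X x /\ exists eps, 0 < eps /\
    forall y, aff_hull X y -> vnorm (vsub y x) < eps -> X y.

Definition is_subgrad n (F : vec n -> R) (z d : vec n) : Prop :=
  forall w, F z + dot d (vsub w z) <= F w.

Definition is_proj n (X : vec n -> Prop) (z p : vec n) : Prop :=
  X p /\ forall q, X q -> vnorm (vsub z p) <= vnorm (vsub z q).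

Definition haff n nu (A : 'I_nu -> vec n) (b : 'I_nu -> R) (l : 'I_nu) (x : vec n) : R :=
  dot (A l) x - b l.

Definition ftot n N (f : 'I_N -> vec n -> R) (x : vec n) : R := sumI (fun i => f i x).

Definition feasible n m nu (X : vec n -> Prop) (g : 'I_m -> vec n -> R)
  (A : 'I_nu -> vec n) (b : 'I_nu -> R) (x : vec n) : Prop :=
  X x /\ (forall l, g l x <= 0) /\ (forall l, haff A b l x = 0).

Definition is_inf (S : R -> Prop) (p : R) : Prop :=
  (forall y, S y -> p <= y) /\ (forall q, (forall y, S y -> q <= y) -> q <= p).

Definition opt_value n N m nu (f : 'I_N -> vec n -> R) (X : vec n -> Prop)
  (g : 'I_m -> vec n -> R) (A : 'I_nu -> vec n) (b : 'I_nu -> R) (p : R) : Prop :=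
  is_inf (fun v => exists x, feasible X g A b x /\ v = ftot f x) p.

Definition optimal n N m nu (f : 'I_N -> vec n -> R) (X : vec n -> Prop)
  (g : 'I_m -> vec n -> R) (A : 'I_nu -> vec n) (b : 'I_nu -> R) (x : vec n) : Prop :=
  feasible X g A b x /\ forall y, feasible X g A b y -> ftot f x <= ftot f y.

Definition slater n m nu (X : vec n -> Prop) (g : 'I_m -> vec n -> R)
  (A : 'I_nu -> vec n) (b : 'I_nu -> R) : Prop :=
  (exists xb, X xb /\ (forall l, g l xb < 0) /\ (forall l, haff A b l xb = 0)) /\
  (exists xt, rel_interior X xt /\ (forall l, haff A b l xt = 0)).

(* network: a k i j = a^i_j(k) *)
Definition non_degenerate N (a : nat -> 'I_N -> 'I_N -> R) : Prop :=
  exists eta, 0 < eta /\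
    forall k i j, 0 <= a k i j /\ eta <= a k i i /\
      (i <> j -> a k i j = 0 \/ (eta <= a k i j /\ a k i j <= 1)).

Definition balanced N (a : nat -> 'I_N -> 'I_N -> R) : Prop :=
  forall k, (forall i, sumI (fun j => a k i j) = 1) /\ (forall j, sumI (fun i => a k i j) = 1).

Definition edge N (a : nat -> 'I_N -> 'I_N -> R) (k : nat) (j i : 'I_N) : Prop :=
  j <> i /\ a k i j > 0.

Definition union_edge N (a : nat -> 'I_N -> 'I_N -> R) (B k0 : nat) (j i : 'I_N) : Prop :=
  exists k, (k < B)%nat /\ edge a (k0 + k) j i.

Definition strongly_connected N (E : 'I_N -> 'I_N -> Prop) : Prop :=
  forall i j : 'I_N, clos_refl_trans 'I_N E i j.

Definition periodic_strong_conn N (a : nat -> 'I_N -> 'I_N -> R) : Prop :=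
  exists B, (1 <= B)%nat /\ forall k0, strongly_connected (union_edge a B k0).

Definition ssum (alpha : nat -> R) (k : nat) : R := sum_f_R0 alpha k.

Definition series_cv (u : nat -> R) : Prop := exists l, Un_cv (sum_f_R0 u) l.

Definition step_size (alpha : nat -> R) : Prop :=
  (forall k, 0 < alpha k) /\
  Un_cv alpha 0 /\
  cv_infty (ssum alpha) /\
  series_cv (fun k => alpha k ^ 2) /\
  Un_cv (fun k => alpha k.+1 * ssum alpha k) 0 /\
  series_cv (fun k => alpha k.+1 ^ 2 * ssum alpha k) /\
  series_cv (fun k => alpha k.+1 ^ 2 * ssum alpha k ^ 2).

Definition DPPDS n N m nu (f : 'I_N -> vec n -> R) (X : vec n -> Prop)
  (g : 'I_m -> vec n -> R) (A : 'I_nu -> vec n) (b : 'I_nu -> R)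
  (a : nat -> 'I_N -> 'I_N -> R) (alpha : nat -> R)
  (x : 'I_N -> nat -> vec n) (y : 'I_N -> nat -> R)
  (mu : 'I_N -> nat -> 'I_m -> R) (lam : 'I_N -> nat -> 'I_nu -> R) : Prop :=
  let vx i k := vsum (fun j => vscale (a k i j) (x j k)) in
  let vy i k := sumI (fun j => a k i j * y j k) in
  let vmu i k := fun l => sumI (fun j => a k i j * mu j k l) in
  let vlam i k := fun l => sumI (fun j => a k i j * lam j k l) in
  (forall i, X (x i 0%nat)) /\
  (forall i l, 0 <= mu i 0%nat l) /\
  (forall i l, 0 <= lam i 0%nat l) /\
  (forall i, y i 1%nat = INR N * f i (x i 0%nat)) /\
  (exists (df : 'I_N -> nat -> vec n) (dg : 'I_N -> nat -> 'I_m -> vec n)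
          (dh : 'I_N -> nat -> 'I_nu -> vec n),
     (forall i k, is_subgrad (f i) (vx i k) (df i k)) /\
     (forall i k l, is_subgrad (fun z => Rmax 0 (g l z)) (vx i k) (dg i k l)) /\
     (forall i k l, is_subgrad (fun z => Rabs (haff A b l z)) (vx i k) (dh i k l)) /\
     (forall i k,
        is_proj X
          (vsub (vx i k)
                (vscale (alpha k)
                   (vadd (df i k)
                     (vadd (vsum (fun l => vscale (vmu i k l) (dg i k l)))
                           (vsum (fun l => vscale (vlam i k l) (dh i k l)))))))
          (x i k.+1))) /\
  (forall i k l, mu i k.+1 l = vmu i k l + alpha k * Rmax 0 (g l (vx i k))) /\
  (forall i k l, lam i k.+1 l = vlam i k l + alpha k * Rabs (haff A b l (vx i k))) /\
  (forall i k, (1 <= k)%nat ->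
     y i k.+1 = vy i k + INR N * (f i (x i k) - f i (x i k.-1))).

(* Main.v *)
(** Let [gamma] exceed an exact penalty constant of the problem, which exists by Slater's condition.
    For feasible [w], the energy
      [sum_i (|x_i(k) - w|^2 + sum_l (mu_i(k)_l - gamma)^2 + sum_l (lam_i(k)_l - gamma)^2)]
    decreases at each step by [2 alpha(k)] times the optimality gap of the penalized cost at the
    state of one fixed agent, up to summable errors. No bound on the multipliers is needed for this:
    the terms bilinear in multipliers and violations cancel between the primal and the dual step,
    and the remaining errors are controlled by the disagreement between agents, which is square
    summable because averaging contracts the spread over a fixed number of steps. As [sum alpha]
    diverges, the gap has arbitrarily small terms, so some subsequence converges to an optimal [xt].
    The energy for [w = xt] converges, and so do the multipliers, whose network averages are
    nondecreasing and bounded; hence [sum_i |x_i(k) - xt|^2] converges, necessarily to [0].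
    Finally [sum_i y_i(k+1) = N sum_i f_i(x_i(k))] and the [y_i] reach consensus. *)

Require Import Defs.
From Stdlib Require Import Reals Relations Lra Classical ClassicalEpsilon.
From Stdlib Require Import FunctionalExtensionality.
From HB Require Import structures.
From mathcomp Require Import ssreflect ssrfun ssrbool eqtype ssrnat seq fintype bigop finset.

Set Implicit Arguments.
Unset Strict Implicit.
Unset Printing Implicit Defensive.
Local Open Scope R_scope.

(** * Finite sums *)

(** The obstacle is that the multipliers have no a priori uniform bound: they are only known to grow
    at most like [1 + step_sum alpha k], and the search directions with them. This growth is weighed
    against the step sizes: [alpha k * (1 + step_sum alpha k)] is square summable, which is what
    both the quadratic error of the primal step and the perturbed averaging of the states call for.
    A uniform bound on the multipliers comes out a posteriori, from the bounded energy.

    Putting [gamma] in every dual coordinate takes the place of a dual optimal point. Each agent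
    contributes [gamma] times the violation, hence the penalty weight [INR N * gamma]; taking
    [gamma = c + 1] for a penalty constant [c] leaves a unit of slack, which forces cluster points
    of near minimizers to be feasible.

    The energy is therefore used around two reference points, an arbitrary optimal one and [xt]; the
    error sequence is fixed before the reference point, so it serves both. *)

Lemma RplusA : associative Rplus. Proof. by move=> u v w; ring. Qed.
Lemma RplusC : commutative Rplus. Proof. by move=> u v; ring. Qed.
Lemma Rplus0 : left_id 0 Rplus. Proof. by move=> u; ring. Qed.
HB.instance Definition _ := Monoid.isComLaw.Build R 0 Rplus RplusA RplusC Rplus0.

Section Sums.
Variable n : nat.
Implicit Types F G : 'I_n -> R.

Lemma sumI_ext F G : (forall i, F i = G i) -> sumI F = sumI G.
Proof. by move=> H; apply: eq_bigr => i _. Qed.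

Lemma sumI_add F G : sumI (fun i => F i + G i) = sumI F + sumI G.
Proof. exact: big_split. Qed.

Lemma sumI_scal c F : sumI (fun i => c * F i) = c * sumI F.
Proof. by rewrite /sumI; elim/big_rec2: _ => [|i u v _ ->]; ring. Qed.

Lemma sumI_scalr c F : sumI (fun i => F i * c) = sumI F * c.
Proof. by rewrite Rmult_comm -sumI_scal; apply: sumI_ext => i; ring. Qed.

Lemma sumI_opp F : sumI (fun i => - F i) = - sumI F.
Proof. by rewrite /sumI; elim/big_rec2: _ => [|i u v _ ->]; ring. Qed.

Lemma sumI_sub F G : sumI (fun i => F i - G i) = sumI F - sumI G.
Proof. by rewrite sumI_add sumI_opp. Qed.

Lemma sumI_const c : sumI (fun _ : 'I_n => c) = INR n * c.
Proof.
rewrite /sumI big_const card_ord; elim: n => [|k IH]; first by rewrite /=; ring.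
by rewrite iterS IH S_INR; ring.
Qed.

Lemma sumI_eq0 F : (forall i, F i = 0) -> sumI F = 0.
Proof. by move=> H; rewrite (@sumI_ext F (fun _ => 0)) // sumI_const; ring. Qed.

Lemma sumI_le F G : (forall i, F i <= G i) -> sumI F <= sumI G.
Proof.
move=> H; rewrite /sumI; elim/big_rec2: _ => [|i u v _ h]; first lra.
by move: (H i); lra.
Qed.

Lemma sumI_ge0 F : (forall i, 0 <= F i) -> 0 <= sumI F.
Proof. by move=> H; have := @sumI_le (fun _ => 0) F H; rewrite sumI_const; lra. Qed.

Lemma sumI_term F i : (forall j, 0 <= F j) -> F i <= sumI F.
Proof.
move=> H; have -> : sumI F = F i + \big[Rplus/0]_(j < n | j != i) F j by exact: (bigD1 i).
suff h : 0 <= \big[Rplus/0]_(j < n | j != i) F j by lra.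
by elim/big_rec: _ => [|j u _ h]; [lra | move: (H j); lra].
Qed.

Lemma sumI_Rabs F : Rabs (sumI F) <= sumI (fun i => Rabs (F i)).
Proof.
rewrite /sumI; elim/big_rec2: _ => [|i u v _ h]; first by rewrite Rabs_R0; lra.
by apply: Rle_trans (Rabs_triang _ _) _; lra.
Qed.

Lemma sumI_delta F i : sumI (fun j => if j == i then F j else 0) = F i.
Proof.
rewrite /sumI (bigD1 i) //= eqxx big1 ?Rplus_0_r //.
by move=> j /negbTE ->.
Qed.

End Sums.

Lemma sumI_recl n (F : 'I_n.+1 -> R) : sumI F = F ord0 + sumI (fun i : 'I_n => F (lift ord0 i)).
Proof. exact: big_ord_recl. Qed.

Lemma sumI_recr n (F : nat -> R) :
  sumI (fun i : 'I_n.+1 => F i) = sumI (fun i : 'I_n => F i) + F n.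
Proof. exact: (big_ord_recr n). Qed.

Lemma sumI_ord0 (F : 'I_0 -> R) : sumI F = 0.
Proof. exact: big_ord0. Qed.

Lemma sumI_exch n p (F : 'I_n -> 'I_p -> R) :
  sumI (fun i => sumI (fun j => F i j)) = sumI (fun j => sumI (fun i => F i j)).
Proof. exact: exchange_big. Qed.

(** Finitely many witnesses merge into one by summing their absolute values. It makes Lipschitz
    constants and Slater margins common to all indices. *)
Lemma uniform_bound n (P : 'I_n -> R -> Prop) :
  (forall l M M', M <= M' -> P l M -> P l M') -> (forall l, exists M, P l M) ->
  exists M, 0 <= M /\ forall l, P l M.
Proof.
move=> mono ex.
have H l : {M | P l M} by apply: constructive_indefinite_description.
exists (sumI (fun l => Rabs (proj1_sig (H l)))); split.
  by apply: sumI_ge0 => l; apply: Rabs_pos.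
move=> l; apply: (mono _ _ _ _ (proj2_sig (H l))).
apply: Rle_trans (Rle_abs _) _.
apply: (@sumI_term _ (fun l => Rabs (proj1_sig (H l)))) => j; exact: Rabs_pos.
Qed.

Lemma exists_argmax n (z : 'I_n -> R) (i0 : 'I_n) : exists p, forall i, z i <= z p.
Proof.
suff H (r : seq 'I_n) : exists p, forall i, i \in r -> z i <= z p.
  by have [p Hp] := H (enum 'I_n); exists p => i; apply: Hp; rewrite mem_enum.
elim: r => [|j r [p Hp]]; first by exists i0.
case: (Rle_dec (z j) (z p)) => h.
  by exists p => i; rewrite inE => /orP[/eqP -> // | /Hp].
exists j => i; rewrite inE => /orP[/eqP -> | /Hp]; lra.
Qed.

(** * Limits *)

Lemma cv0_le u v : (forall k, Rabs (u k) <= v k) -> Un_cv v 0 -> Un_cv u 0.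
Proof.
move=> H hv e /hv [K HK]; exists K => k /HK; rewrite /R_dist !Rminus_0_r => h.
by apply: Rle_lt_trans (H k) _; move: h; split_Rabs; lra.
Qed.

Lemma cv_shift u l : Un_cv (fun k => u k.+1) l -> Un_cv u l.
Proof.
move=> H e /H [K HK]; exists K.+1 => -[|k] hk; first by move/leP: hk.
by apply: HK; apply/leP; move/leP: hk.
Qed.

Lemma cv0_add u v : Un_cv u 0 -> Un_cv v 0 -> Un_cv (fun k => u k + v k) 0.
Proof. by move=> hu hv; rewrite -[0]Rplus_0_l; apply: CV_plus. Qed.

Lemma cv0_scal c u : Un_cv u 0 -> Un_cv (fun k => c * u k) 0.
Proof.
move=> hu; rewrite -[0](Rmult_0_r c); apply: (CV_mult (fun _ => c)) => //.
by move=> e e0; exists 0%nat => k _; rewrite R_dist_eq.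
Qed.

Lemma cv_sumI n (u : 'I_n -> nat -> R) (l : 'I_n -> R) :
  (forall i, Un_cv (u i) (l i)) -> Un_cv (fun k => sumI (fun i => u i k)) (sumI l).
Proof.
elim: n u l => [|n IH] u l H.
  by rewrite sumI_ord0 => e e0; exists 0%nat => k _; rewrite sumI_ord0 R_dist_eq.
rewrite sumI_recl.
apply: (@Un_cv_ext (fun k => u ord0 k + sumI (fun i : 'I_n => u (lift ord0 i) k))).
  by move=> k; rewrite sumI_recl.
exact: CV_plus (H _) (IH _ _ (fun i => H _)).
Qed.

Lemma cv0_sumI n (u : 'I_n -> nat -> R) :
  (forall i, Un_cv (u i) 0) -> Un_cv (fun k => sumI (fun i => u i k)) 0.
Proof. by move=> H; have := cv_sumI H; rewrite sumI_eq0. Qed.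

Lemma cv_inv_succ : Un_cv (fun j => / INR j.+1) 0.
Proof.
move=> e e0; have [K HK] := INR_unbounded (/ e).
exists K => k hk; rewrite /R_dist Rminus_0_r.
have kp : 0 < INR k.+1 by apply: lt_0_INR; apply/ltP.
have hKk : INR K <= INR k by apply: le_INR.
rewrite Rabs_pos_eq; last by left; apply: Rinv_0_lt_compat.
rewrite -(Rinv_inv e); apply: Rinv_lt_contravar; last by rewrite S_INR; lra.
by apply: Rmult_lt_0_compat => //; apply: Rinv_0_lt_compat.
Qed.

Lemma increasing_ge_id (phi : nat -> nat) :
  (forall k, (phi k < phi k.+1)%nat) -> forall k, (k <= phi k)%nat.
Proof. by move=> H; elim=> // k IH; apply: leq_ltn_trans IH (H k). Qed.

Lemma cv_subseq u l (phi : nat -> nat) :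
  (forall k, (k <= phi k)%nat) -> Un_cv u l -> Un_cv (fun k => u (phi k)) l.
Proof.
move=> H hu e /hu [K HK]; exists K => k /leP hk; apply: HK; apply/leP.
exact: leq_trans hk (H k).
Qed.

(** * Summable and square-summable sequences *)

(** Nonnegative terms with bounded partial sums: comparison and addition then work on bounds alone,
    and a limit is produced only where it is used. *)
Definition summable (u : nat -> R) : Prop :=
  (forall k, 0 <= u k) /\ exists M, forall K, sum_f_R0 u K <= M.

Definition square_summable (u : nat -> R) : Prop := summable (fun k => u k ^ 2).

Lemma summable_le u v : (forall k, 0 <= u k <= v k) -> summable v -> summable u.
Proof.
move=> H [_ [M HM]]; split=> [k|]; first by case: (H k).
exists M => K; apply: Rle_trans (HM K); apply: sum_Rle => k _.
by case: (H k).
Qed.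

Lemma summable_add u v : summable u -> summable v -> summable (fun k => u k + v k).
Proof.
move=> [u0 [M HM]] [v0 [M' HM']]; split=> [k|]; first by move: (u0 k) (v0 k); lra.
by exists (M + M') => K; rewrite plus_sum; move: (HM K) (HM' K); lra.
Qed.

Lemma summable_scal c u : 0 <= c -> summable u -> summable (fun k => c * u k).
Proof.
move=> c0 [u0 [M HM]]; split=> [k|]; first exact: Rmult_le_pos.
exists (c * M) => K.
rewrite (PartSum.sum_eq _ (fun k => u k * c)); last by move=> *; ring.
by rewrite -scal_sum; apply: Rmult_le_compat_l.
Qed.

Lemma summable_shift u : (forall k, 0 <= u k) -> summable (fun k => u k.+1) -> summable u.
Proof.
move=> u0 [_ [M HM]]; split=> //; exists (u 0%nat + M) => -[|K].
  by rewrite /=; move: (HM 0%nat) (u0 1%nat) => /=; lra.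
rewrite decomp_sum; last by apply/ltP.
by move: (HM K) => /=; lra.
Qed.

Lemma summable_unshift u : summable u -> summable (fun k => u k.+1).
Proof.
move=> [u0 [M HM]]; split=> [k //|]; exists M => K.
move: (HM K.+1); rewrite decomp_sum; last by apply/ltP.
by move: (u0 0%nat) => /=; lra.
Qed.

Lemma series_cv_summable u : (forall k, 0 <= u k) -> series_cv u -> summable u.
Proof. by move=> u0 [l Hl]; split=> //; exists l => K; apply: sum_incr. Qed.

Lemma summable_series_cv u : summable u -> series_cv u.
Proof.
move=> [u0 [M HM]].
case: (growing_cv (sum_f_R0 u)) => [k /=|| l Hl]; last by exists l.
  by move: (u0 k.+1); lra.
by exists M => v [k ->].
Qed.

Lemma summable_cv0 u : summable u -> Un_cv u 0.
Proof.
move=> su; have [l Hl] := summable_series_cv su.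
have u0 := proj1 su.
move=> e e0; have [K HK] := Hl (e / 2) ltac:(lra).
exists K.+1 => -[|k] Hk; first by move/leP: Hk.
have h1 := HK k.+1 ltac:(apply/leP; move/leP: Hk; exact: ltnW).
have h2 := HK k ltac:(by apply/leP; move/leP: Hk).
move: h1 h2; rewrite /R_dist /=; move: (u0 k.+1).
by rewrite Rminus_0_r; split_Rabs; lra.
Qed.

(** Summing the recursion bounds the shifted sum by [1 - d] times the full sum plus [M]. The shift
    loses only a fixed head, so [d] times the full sum is bounded. *)
Lemma summable_contraction u w (T : nat) d :
  0 < d -> (forall k, 0 <= u k) -> summable w ->
  (forall k, u (k + T)%nat <= (1 - d) * u k + w k) -> summable u.
Proof.
move=> d0 u0 [w0 [M HM]] H; split=> //.
exists ((sum_f_R0 u T + M) / d) => K.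
apply: (Rmult_le_reg_l d) => //.
have -> : d * ((sum_f_R0 u T + M) / d) = sum_f_R0 u T + M by field; lra.
have h1 : sum_f_R0 (fun k => u (k + T)%nat) K <= (1 - d) * sum_f_R0 u K + sum_f_R0 w K.
  elim: K => [|K IH] /=; first exact: H.
  by move: (H K.+1); lra.
have h2 : sum_f_R0 u K <= sum_f_R0 u T + sum_f_R0 (fun k => u (k + T)%nat) K.
  have mono k : sum_f_R0 u K <= sum_f_R0 u (K + k)%nat.
    elim: k => [|k IH]; first by rewrite addn0; lra.
    by rewrite addnS /=; move: (u0 (K + k).+1); lra.
  apply: Rle_trans (mono T) _.
  elim: {mono h1} K => [|K IH].
    by rewrite /= add0n; move: (u0 T); lra.
  by rewrite /= addSn /=; lra.
by move: (HM K); lra.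
Qed.

Lemma square_summable_le u v :
  (forall k, 0 <= u k <= v k) -> square_summable v -> square_summable u.
Proof.
move=> H; apply: summable_le => k; split; first exact: pow2_ge_0.
by apply: pow_incr.
Qed.

Lemma square_summable_add u v :
  square_summable u -> square_summable v -> square_summable (fun k => u k + v k).
Proof.
move=> su sv.
apply: (@summable_le _ (fun k => 2 * (u k ^ 2) + 2 * (v k ^ 2))); last first.
  by apply: summable_add; apply: summable_scal => //; lra.
move=> k; split; first exact: pow2_ge_0.
by have := pow2_ge_0 (u k - v k); nra.
Qed.

Lemma square_summable_scal c u : square_summable u -> square_summable (fun k => c * u k).
Proof.
move=> su.
apply: (@summable_le _ (fun k => c ^ 2 * (u k ^ 2))); last first.
  by apply: summable_scal => //; apply: pow2_ge_0.
by move=> k; split; [apply: pow2_ge_0 | rewrite Rpow_mult_distr; lra].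
Qed.

Lemma square_summable_shift u : square_summable (fun k => u k.+1) -> square_summable u.
Proof. by apply: summable_shift => k; apply: pow2_ge_0. Qed.

Lemma square_summable_unshift u : square_summable u -> square_summable (fun k => u k.+1).
Proof. by move/summable_unshift. Qed.

Lemma square_summable_sumI n (u : 'I_n -> nat -> R) :
  (forall i, square_summable (u i)) -> square_summable (fun k => sumI (fun i => u i k)).
Proof.
elim: n u => [|n IH] u H.
  apply: (@summable_le _ (fun k => 0 * (0 * 0) ^ 2)).
    by move=> k; rewrite sumI_ord0; lra.
  split=> [k|]; first lra.
  by exists 0 => K; rewrite sum_eq_R0 // => *; lra.
apply: (@summable_le _ (fun k => (u ord0 k + sumI (fun i : 'I_n => u (lift ord0 i) k)) ^ 2)).
  by move=> k; split; [apply: pow2_ge_0 | rewrite sumI_recl; lra].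
by apply: square_summable_add (H _) (IH _ _).
Qed.

Lemma summable_mul u v : (forall k, 0 <= u k) -> (forall k, 0 <= v k) ->
  square_summable u -> square_summable v -> summable (fun k => u k * v k).
Proof.
move=> u0 v0 su sv; apply: (@summable_le _ (fun k => u k ^ 2 + v k ^ 2)); last exact: summable_add.
move=> k; split; first exact: Rmult_le_pos.
by move: (u0 k) (v0 k); nra.
Qed.

Lemma square_summable_cv0 u : square_summable u -> Un_cv u 0.
Proof.
move=> /summable_cv0 H e e0; have [K HK] := H (e ^ 2) ltac:(nra).
exists K => k /HK; rewrite /R_dist !Rminus_0_r => h.
rewrite Rabs_pos_eq in h; last exact: pow2_ge_0.
by rewrite -(Rabs_pos_eq e); [apply: Rsqr_lt_abs_0; rewrite /Rsqr; lra | lra].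
Qed.

(** The deterministic Robbins-Siegmund lemma: [u] minus the accumulated errors decreases and is
    bounded below, and what [d] removes in total is paid from the initial value and the errors. *)
Lemma quasi_decreasing_cv u r d : (forall k, 0 <= u k) -> (forall k, 0 <= d k) -> summable r ->
  (forall k, u k.+1 <= u k + r k - d k) ->
  [/\ exists l, Un_cv u l, exists M, forall k, u k <= M & summable d].
Proof.
move=> u0 d0 sr H.
have [R0 HR0] := summable_series_cv sr.
have [r0 [M HM]] := sr.
have bnd k : u k.+1 + sum_f_R0 d k <= u 0%nat + sum_f_R0 r k.
  by elim: k => [|k IH] /=; [move: (H 0%nat) | move: (H k.+1)]; lra.
have dge k : 0 <= sum_f_R0 d k by apply: cond_pos_sum.
split; last 1 first.
- by split=> //; exists (u 0%nat + M) => K; move: (bnd K) (HM K) (u0 K.+1); lra.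
(* [sum_f_R0 r k] includes the term [r k], so it is paired with [u k.+1]; the index shift is undone
   by [cv_shift]. *)
- have [] := @decreasing_cv (fun k => u k.+1 - sum_f_R0 r k).
  + by move=> k /=; move: (H k.+1) (d0 k.+1); lra.
  + exists M => v [k ->]; rewrite /opp_seq.
    by move: (u0 k.+1) (HM k); lra.
  + move=> l Hl; exists (l + R0).
    have hs : Un_cv (fun k => u k.+1) (l + R0).
      apply: Un_cv_ext (CV_plus _ _ _ _ Hl HR0) => k /=; ring.
    exact: cv_shift.
- have M0 : 0 <= M by apply: Rle_trans (HM 0%nat); apply: cond_pos_sum.
  exists (u 0%nat + M) => -[|k]; first lra.
  by move: (bnd k) (HM k) (dge k); lra.
Qed.

(* Otherwise [d] would be bounded below from some point on, making [sum alpha d] diverge. *)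
Lemma small_terms alpha d : (forall k, 0 < alpha k) -> cv_infty (ssum alpha) ->
  (forall k, 0 <= d k) -> summable (fun k => alpha k * d k) ->
  forall e j, 0 < e -> exists k, (j <= k)%nat /\ d k < e.
Proof.
move=> a0 ainf d0 [_ [M HM]] e j e0; apply: NNPP => hn.
have big k : (j <= k)%nat -> e <= d k.
  by move=> jk; apply: Rnot_lt_le => h; apply: hn; exists k.
have lb K : e * (ssum alpha (j + K) - ssum alpha j) <= sum_f_R0 (fun k => alpha k * d k) (j + K).
  elim: K => [|K IH].
    by rewrite addn0 Rminus_diag Rmult_0_r; apply: cond_pos_sum => k; apply: Rmult_le_pos (d0 k); left.
  have hS : ssum alpha (j + K).+1 = ssum alpha (j + K) + alpha (j + K).+1 by [].
  rewrite addnS hS /=.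
  have := Rmult_le_compat_l _ _ _ (Rlt_le _ _ (a0 (j + K).+1)) (big (j + K).+1 _).
  by move=> /(_ (leqW (leq_addr _ _))); move: IH; lra.
have [K HK] := ainf (M / e + ssum alpha j).
have h1 := HK (j + K)%nat ltac:(apply/leP; exact: leq_addl).
have h2 := lb K; have h3 := HM (j + K)%nat.
have : e * (M / e) < e * (ssum alpha (j + K) - ssum alpha j) by apply: Rmult_lt_compat_l; lra.
have -> : e * (M / e) = M by field; lra.
by lra.
Qed.

(** * Perturbed consensus *)

(** The default value 0 makes this the maximum of 0 and the entries. Inside [spread] it changes
    nothing, because the diagonal differences are 0. *)
Definition maxI n (F : 'I_n -> R) : R := \big[Rmax/0]_(i < n) F i.

Lemma maxI_ge n (F : 'I_n -> R) i : F i <= maxI F.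
Proof.
rewrite /maxI; have: i \in index_enum 'I_n by rewrite mem_index_enum.
elim: (index_enum _) => [//|j r IH]; rewrite inE big_cons => /orP[/eqP -> | /IH h].
  exact: Rmax_l.
by apply: Rle_trans h (Rmax_r _ _).
Qed.

Lemma maxI_le n (F : 'I_n -> R) M : 0 <= M -> (forall i, F i <= M) -> maxI F <= M.
Proof. by move=> M0 H; rewrite /maxI; elim/big_rec: _ => // i u _ h; apply: Rmax_lub. Qed.

Lemma maxI_ge0 n (F : 'I_n -> R) : 0 <= maxI F.
Proof.
rewrite /maxI; elim/big_rec: _ => [|i u _ h]; first lra.
by apply: Rle_trans h (Rmax_r _ _).
Qed.

Definition spread n (z : 'I_n -> R) : R := maxI (fun i => maxI (fun j => z i - z j)).

Lemma spread_ge n (z : 'I_n -> R) i j : z i - z j <= spread z.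
Proof.
apply: Rle_trans (maxI_ge (fun j => z i - z j) j) _.
exact: (maxI_ge (fun i => maxI (fun j => z i - z j)) i).
Qed.

Lemma Rabs_spread n (z : 'I_n -> R) i j : Rabs (z i - z j) <= spread z.
Proof. by apply: Rabs_le; move: (spread_ge z i j) (spread_ge z j i); lra. Qed.

Lemma spread_le n (z : 'I_n -> R) M : 0 <= M -> (forall i j, z i - z j <= M) -> spread z <= M.
Proof. by move=> M0 H; do 2 apply: maxI_le => // ?. Qed.

Lemma spread_ge0 n (z : 'I_n -> R) : 0 <= spread z.
Proof. exact: maxI_ge0. Qed.

Lemma INR_ord_gt0 n (i : 'I_n) : 0 < INR n.
Proof. by apply: lt_0_INR; apply/ltP; apply: leq_ltn_trans (ltn_ord i). Qed.

Lemma Rabs_sub_mean n (z : 'I_n -> R) i : Rabs (z i - / INR n * sumI z) <= spread z.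
Proof.
have n0 := INR_ord_gt0 i; have n0' := Rinv_0_lt_compat _ n0.
have -> : z i - / INR n * sumI z = / INR n * sumI (fun j => z i - z j).
  by rewrite sumI_sub sumI_const; field; lra.
rewrite Rabs_mult Rabs_pos_eq; last lra.
apply: Rle_trans (_ : / INR n * (INR n * spread z) <= _); last by right; field; lra.
apply: Rmult_le_compat_l; first lra.
rewrite -sumI_const; apply: Rle_trans (sumI_Rabs _) _; apply: sumI_le => j.
exact: Rabs_spread.
Qed.

Section Averaging.
Variables (N : nat) (a : nat -> 'I_N -> 'I_N -> R).
Hypotheses (a_nondeg : non_degenerate a) (a_bal : balanced a).

Definition avg (k : nat) (z : 'I_N -> R) : 'I_N -> R := fun i => sumI (fun j => a k i j * z j).

Lemma weight_ge0 k i j : 0 <= a k i j.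
Proof. by have [eta [_ /(_ k i j) []]] := a_nondeg. Qed.

Lemma avg_le k z z' i : (forall j, z j <= z' j) -> avg k z i <= avg k z' i.
Proof. by move=> H; apply: sumI_le => j; apply: Rmult_le_compat_l (weight_ge0 _ _ _) (H j). Qed.

Lemma avg_const k c i : avg k (fun _ => c) i = c.
Proof. by rewrite /avg sumI_scalr (proj1 (a_bal k)); ring. Qed.

Lemma avg_add k z z' i : avg k (fun j => z j + z' j) i = avg k z i + avg k z' i.
Proof. by rewrite /avg -sumI_add; apply: sumI_ext => j; ring. Qed.

Lemma avg_ext k z z' i : (forall j, z j = z' j) -> avg k z i = avg k z' i.
Proof. by move=> H; apply: sumI_ext => j; rewrite H. Qed.

Lemma avg_ub k z M i : (forall j, z j <= M) -> avg k z i <= M.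
Proof. by move=> H; rewrite -(avg_const k M i); apply: avg_le. Qed.

Lemma avg_lb k z M i : (forall j, M <= z j) -> M <= avg k z i.
Proof. by move=> H; rewrite -{1}(avg_const k M i); apply: avg_le. Qed.

Lemma sum_avg k z : sumI (avg k z) = sumI z.
Proof.
rewrite /avg sumI_exch; apply: sumI_ext => j.
by rewrite sumI_scalr (proj2 (a_bal k)); ring.
Qed.

Lemma Rabs_avg_sub k z i j : Rabs (avg k z i - z j) <= spread z.
Proof.
apply: Rabs_le; split.
  suff: z j - spread z <= avg k z i by lra.
  by apply: avg_lb => l; move: (spread_ge z j l); lra.
suff: avg k z i <= z j + spread z by lra.
by apply: avg_ub => l; move: (spread_ge z l j); lra.
Qed.

(** The unperturbed averaging started at time [k], with which the actual sequence is compared over a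
    window of [t] steps. *)
Fixpoint run (k t : nat) (z : 'I_N -> R) : 'I_N -> R :=
  if t is t'.+1 then avg (k + t') (run k t' z) else z.

Lemma run_add k t z c i : run k t (fun j => z j + c) i = run k t z i + c.
Proof.
elim: t i => [//|t IH] i /=.
by rewrite (avg_ext _ _ IH) avg_add avg_const.
Qed.

Lemma run_ub k t z M i : (forall j, z j <= M) -> run k t z i <= M.
Proof. by move=> H; elim: t i => [//|t IH] i /=; apply: avg_ub. Qed.

Lemma run_ge0 k t z i : (forall j, 0 <= z j) -> 0 <= run k t z i.
Proof. by move=> H; elim: t i => [//|t IH] i /=; apply: avg_lb. Qed.

(** Averaging is monotone and fixes constants, so it never amplifies an error in the sup norm: the
    defects of the single steps just add up. *)
Lemma run_close z e k t i :
  (forall k i, Rabs (z k.+1 i - avg k (z k) i) <= e k) ->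
  Rabs (z (k + t)%nat i - run k t (z k) i) <= sumI (fun s : 'I_t => e (k + s)%nat).
Proof.
move=> He; elim: t i => [|t IH] i.
  by rewrite addn0 /= sumI_ord0 Rminus_diag Rabs_R0; lra.
rewrite addnS (@sumI_recr t (fun s => e (k + s)%nat)) /=.
set S := sumI _ in IH *.
have h : Rabs (avg (k + t) (z (k + t)%nat) i - avg (k + t) (run k t (z k)) i) <= S.
  apply: Rabs_le; split.
  - suff h : avg (k + t) (run k t (z k)) i <= avg (k + t) (fun j => z (k + t)%nat j + S) i.
      by move: h; rewrite avg_add avg_const; lra.
    by apply: avg_le => j; move: (IH j); split_Rabs; lra.
  - suff h : avg (k + t) (z (k + t)%nat) i <= avg (k + t) (fun j => run k t (z k) j + S) i.
      by move: h; rewrite avg_add avg_const; lra.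
    by apply: avg_le => j; move: (IH j); split_Rabs; lra.
by move: (He (k + t)%nat i) h; split_Rabs; lra.
Qed.

Lemma crossing_edge (E : 'I_N -> 'I_N -> Prop) (S : {set 'I_N}) i j :
  clos_refl_trans _ E i j -> i \in S -> j \notin S ->
  exists p q, [/\ p \in S, q \notin S & E p q].
Proof.
move=> /clos_rt_rt1n_iff; elim=> [{}i h /negP // | {}i l {}j Eil _ IH iS jS].
by case: (boolP (l \in S)) => lS; [apply: IH | exists i, l].
Qed.

(* The set of agents whose value is at least [eta ^ t * z j0] after [t] steps never shrinks,
   and gains an agent in every window of [B] steps until it is full. *)
Lemma run_spreads_out (eta : R) (B k : nat) (z : 'I_N -> R) (j0 : 'I_N) :
  0 < eta ->
  (forall k i j, 0 <= a k i j /\ eta <= a k i i /\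
      (i <> j -> a k i j = 0 \/ (eta <= a k i j /\ a k i j <= 1))) ->
  (forall k0, strongly_connected (union_edge a B k0)) ->
  (forall j, 0 <= z j) ->
  forall i, eta ^ (N * B) * z j0 <= run k (N * B) z i.
Proof.
move=> eta0 Ha conn z0.
pose S t : {set 'I_N} := [set i | if Rle_dec (eta ^ t * z j0) (run k t z i) then true else false].
have inS t i : reflect (eta ^ t * z j0 <= run k t z i) (i \in S t).
  by rewrite inE; case: Rle_dec => h; constructor.
(* Receiving from a member with weight at least [eta] costs one factor [eta]; the other terms of the
   average are nonnegative. *)
have step t i p : eta <= a (k + t) i p -> p \in S t -> i \in S t.+1.
  move=> h /inS hp; apply/inS => /=.
  apply: Rle_trans (_ : a (k + t) i p * run k t z p <= _); last first.
    apply: (@sumI_term _ (fun j => a (k + t) i j * run k t z j)) => j.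
    exact: Rmult_le_pos (weight_ge0 _ _ _) (run_ge0 _ _ _ z0).
  rewrite Rmult_assoc; apply: Rmult_le_compat => //; first lra.
  apply: Rmult_le_pos (z0 _); apply: pow_le; lra.
have mono t d : S t \subset S (t + d)%nat.
  elim: d => [|d IH]; first by rewrite addn0.
  apply: subset_trans IH _; apply/subsetP => i hi; rewrite addnS.
  by apply: step hi; case: (Ha (k + (t + d))%nat i i) => _ [].
(* The strict inequality is what rules out the second alternative at [r = N]. *)
have grow r : (forall i, i \in S (r * B)%nat) \/ (r < #|S (r * B)%nat|)%N.
  elim: r => [|r [IH|IH]].
  - by right; rewrite mul0n; apply/card_gt0P; exists j0; apply/inS => /=; lra.
  - by left => i; rewrite mulSn addnC; apply: (subsetP (mono _ _)).
  - case: (classic (forall i, i \in S (r * B)%nat)) => [h|].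
      by left => i; rewrite mulSn addnC; apply: (subsetP (mono _ _)).
    move=> /not_all_ex_not [q0 /negP hq0]; right.
    have /card_gt0P [p0 hp0] : (0 < #|S (r * B)%nat|)%N by apply: leq_ltn_trans IH.
    have [p [q [hp hq [s [hs [pq apq]]]]]] := crossing_edge (conn (k + r * B)%nat p0 q0) hp0 hq0.
    have qS : q \in S (r.+1 * B)%nat.
      (* The crossing edge is active at offset [s] of the window: [q] joins one step later and stays
         until the window ends. *)
      have -> : (r.+1 * B = (r * B + s).+1 + (B - s.+1))%nat.
        by rewrite -addnS -addnA subnKC // mulSn addnC.
      apply: (subsetP (mono _ _)).
      apply: (@step _ _ p); last exact: (subsetP (mono _ _)).
      rewrite addnA; case: (Ha (k + r * B + s)%nat q p) => _ [_ /(_ (nesym pq)) [|[]]] //; lra.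
    apply: leq_ltn_trans IH _; apply: proper_card; apply/properP; split; last by exists q.
    by rewrite mulSn addnC; apply: mono.
move=> i; apply/inS; case: (grow N) => // h.
by have := leq_trans h (max_card _); rewrite card_ord ltnn.
Qed.

Hypothesis a_conn : periodic_strong_conn a.

(** Subtract the minimum of [z] and let the maximal value spread out: after [N * B] steps every
    agent lies at least [d] times the spread above the old minimum, and still below the old maximum.
    Here [d = eta ^ (N * B)]; the agent [i0] supplies a row sum, whence [eta <= 1]. *)
Lemma run_contracts (i0 : 'I_N) : exists (T : nat) (d : R), 0 < d <= 1 /\
  forall k z, spread (run k T z) <= (1 - d) * spread z.
Proof.
have [eta [eta0 Ha]] := a_nondeg; have [B [_ conn]] := a_conn.
have eta1 : eta <= 1.
  rewrite -(proj1 (a_bal 0%nat) i0); apply: Rle_trans (proj1 (proj2 (Ha 0%nat i0 i0))) _.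
  by apply: (@sumI_term _ (a 0%nat i0)) => j; apply: weight_ge0.
have d01 : 0 < eta ^ (N * B) <= 1.
  by split; [apply: pow_lt | rewrite -(pow1 (N * B)); apply: pow_incr; lra].
exists (N * B)%nat, (eta ^ (N * B)); split=> // k z.
have [p hp] := exists_argmax z i0; have [q hq] := exists_argmax (fun i => - z i) i0.
apply: spread_le.
  by apply: Rmult_le_pos (spread_ge0 _); lra.
move=> i j.
have h1 := run_ub k (N * B) i hp.
have h2 := @run_spreads_out eta B k (fun i => z i + - z q) p eta0 Ha conn
  ltac:(by move=> l; move: (hq l); lra) j.
rewrite run_add in h2.
by move: (spread_ge z p q); nra.
Qed.

(** The consensus statement behind all the iterates: it is applied to each coordinate of the states,
    to each multiplier and to [y], with their respective increments as perturbation. *)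
Lemma spread_square_summable (z : nat -> 'I_N -> R) (e : nat -> R) :
  (forall k, 0 <= e k) -> square_summable e ->
  (forall k i, Rabs (z k.+1 i - avg k (z k) i) <= e k) ->
  square_summable (fun k => spread (z k)).
Proof.
move=> e0 se He.
case: (classic (exists i0 : 'I_N, True)) => [[i0 _]|hN]; last first.
  apply: (@square_summable_le _ e) => // k; split; first exact: spread_ge0.
  by apply: spread_le => // i; case: hN; exists i.
have [T [d [d01 contr]]] := run_contracts i0.
(* The factor 2 is for the two agents compared in a spread, each of which departs from its run. *)
pose w k := 2 * sumI (fun s : 'I_T => e (k + s)%nat).
have w0 k : 0 <= w k.
  by apply: Rmult_le_pos; [lra | apply: sumI_ge0 => s].
have sw : square_summable w.
  apply: square_summable_scal; apply: square_summable_sumI => s.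
  elim: {s}(s : nat) => [|s IH].
    by apply: square_summable_le se => k; rewrite addn0; move: (e0 k); lra.
  apply: square_summable_le (square_summable_unshift IH) => k.
  by rewrite addnS; split=> //; rewrite addSn; lra.
have rec k : spread (z (k + T)%nat) <= (1 - d) * spread (z k) + w k.
  apply: spread_le.
    by apply: Rplus_le_le_0_compat (w0 k); apply: Rmult_le_pos (spread_ge0 _); lra.
  move=> i j; move: (run_close k T i He) (run_close k T j He) (contr k (z k)).
  by move: (spread_ge (run k T (z k)) i j); rewrite /w; split_Rabs; lra.
have sw' : summable (fun k => / d * w k ^ 2).
  by apply: summable_scal => //; left; apply: Rinv_0_lt_compat; lra.
apply: (@summable_contraction _ _ T d _ _ sw'); first lra.
  by move=> k; apply: pow2_ge_0.
move=> k; apply: Rle_trans (_ : ((1 - d) * spread (z k) + w k) ^ 2 <= _).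
  by apply: pow_incr; split=> //; apply: spread_ge0.
(* convexity of the square: [(1-d) s + d (w/d)] *)
have -> : w k = d * (w k / d) by field; lra.
set s := spread _; set v := w k / d.
have -> : / d * (d * v) ^ 2 = d * v ^ 2 by field; lra.
have h : 0 <= (1 - d) * d * (s - v) ^ 2.
  by apply: Rmult_le_pos; [apply: Rmult_le_pos; lra | apply: pow2_ge_0].
by nra.
Qed.

End Averaging.

(** * Vectors and convexity *)

Lemma Rdiv_ge0 u v : 0 <= u -> 0 < v -> 0 <= u / v.
Proof. by move=> u0 v0; apply: Rmult_le_pos => //; left; apply: Rinv_0_lt_compat. Qed.

(** Consensus is obtained coordinate by coordinate, and this norm adds the coordinates up without
    square roots. *)
Definition norm1 n (u : vec n) : R := sumI (fun l => Rabs (u l)).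

Definition box n (r : R) (x : vec n) : Prop := forall l, Rabs (x l) <= r.

Lemma vec_ext n (u v : vec n) : (forall l, u l = v l) -> u = v.
Proof. by move=> H; apply: functional_extensionality. Qed.

Lemma norm1_ge0 n (u : vec n) : 0 <= norm1 u.
Proof. by apply: sumI_ge0 => l; apply: Rabs_pos. Qed.

Lemma norm1_coord n (u : vec n) l : Rabs (u l) <= norm1 u.
Proof. by apply: (@sumI_term _ (fun l => Rabs (u l))) => j; apply: Rabs_pos. Qed.

Lemma dot_ge0 n (u : vec n) : 0 <= dot u u.
Proof. by apply: sumI_ge0 => l; nra. Qed.

Lemma vnorm_sqr n (u : vec n) : vnorm u ^ 2 = dot u u.
Proof. by rewrite /vnorm /= Rmult_1_r sqrt_sqrt //; apply: dot_ge0. Qed.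

Lemma vnorm_ge0 n (u : vec n) : 0 <= vnorm u.
Proof. exact: sqrt_pos. Qed.

Lemma vnorm_coord n (u : vec n) l : Rabs (u l) <= vnorm u.
Proof.
rewrite /vnorm -sqrt_Rsqr_abs; apply: sqrt_le_1_alt.
by apply: (@sumI_term _ (fun l => u l * u l)) => j; nra.
Qed.

Lemma vnorm_le_norm1 n (u : vec n) : vnorm u <= norm1 u.
Proof.
rewrite -(sqrt_Rsqr (norm1 u)); last exact: norm1_ge0.
apply: sqrt_le_1_alt; rewrite /Rsqr {1}/norm1 -sumI_scalr; apply: sumI_le => l.
have h := norm1_coord u l; have h0 := Rabs_pos (u l).
have -> : u l * u l = Rabs (u l) * Rabs (u l) by split_Rabs; ring.
exact: Rmult_le_compat_l.
Qed.

Lemma vnorm_cv0_norm1_cv0 n (u : nat -> vec n) :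
  Un_cv (fun k => vnorm (u k)) 0 -> Un_cv (fun k => norm1 (u k)) 0.
Proof.
move=> H e e0.
have n0 : 0 < INR n + 1 by move: (pos_INR n); lra.
have [K HK] := H (e / (INR n + 1)) ltac:(exact: Rdiv_lt_0_compat).
exists K => k /HK; rewrite /R_dist !Rminus_0_r => h.
rewrite (Rabs_pos_eq (vnorm _)) in h; last exact: vnorm_ge0.
rewrite Rabs_pos_eq; last exact: norm1_ge0.
apply: Rle_lt_trans (_ : INR n * vnorm (u k) < e).
  by rewrite -sumI_const; apply: sumI_le => l; apply: vnorm_coord.
have -> : e = (INR n + 1) * (e / (INR n + 1)) by field; lra.
by move: (pos_INR n) (vnorm_ge0 (u k)); nra.
Qed.

Lemma norm1_cv0_vnorm_cv0 n (u : nat -> vec n) :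
  Un_cv (fun k => norm1 (u k)) 0 -> Un_cv (fun k => vnorm (u k)) 0.
Proof.
apply: cv0_le => k; rewrite Rabs_pos_eq; [exact: vnorm_le_norm1 | exact: vnorm_ge0].
Qed.

Lemma convex_add n (F G : vec n -> R) :
  convex_fun F -> convex_fun G -> convex_fun (fun x => F x + G x).
Proof. by move=> hF hG x y t ht; move: (hF x y t ht) (hG x y t ht); lra. Qed.

Lemma convex_scal n c (F : vec n -> R) :
  0 <= c -> convex_fun F -> convex_fun (fun x => c * F x).
Proof. by move=> c0 hF x y t ht; move: (hF x y t ht); nra. Qed.

Lemma convex_sumI n p (F : 'I_p -> vec n -> R) :
  (forall i, convex_fun (F i)) -> convex_fun (fun x => sumI (fun i => F i x)).
Proof.
move=> hF x y t ht; rewrite -!sumI_scal -sumI_add; apply: sumI_le => i.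
exact: hF.
Qed.

Lemma convex_pos_part n (F : vec n -> R) :
  convex_fun F -> convex_fun (fun x => Rmax 0 (F x)).
Proof.
move=> hF x y t ht; move: (hF x y t ht).
have := Rmax_l 0 (F x); have := Rmax_r 0 (F x); have := Rmax_l 0 (F y); have := Rmax_r 0 (F y).
by move=> *; apply: Rmax_lub; nra.
Qed.

Lemma haff_affine n nu (A : 'I_nu -> vec n) (b : 'I_nu -> R) l x y t :
  haff A b l (vadd (vscale t x) (vscale (1 - t) y)) = t * haff A b l x + (1 - t) * haff A b l y.
Proof.
rewrite /haff /dot.
rewrite (@sumI_ext _ _ (fun i => t * (A l i * x i) + (1 - t) * (A l i * y i))).
  by rewrite sumI_add !sumI_scal; ring.
by move=> i; rewrite /vadd /vscale; ring.
Qed.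

Lemma convex_abs_haff n nu (A : 'I_nu -> vec n) (b : 'I_nu -> R) l :
  convex_fun (fun x => Rabs (haff A b l x)).
Proof.
move=> x y t ht; rewrite haff_affine; apply: Rle_trans (Rabs_triang _ _) _.
by rewrite !Rabs_mult (Rabs_pos_eq t) ?(Rabs_pos_eq (1 - t)); lra.
Qed.

Definition axis n (l : 'I_n) (c : R) : vec n := fun l' => if l' == l then c else 0.

Lemma dot_axis n (l : 'I_n) c (d : vec n) : dot d (axis l c) = d l * c.
Proof.
rewrite /dot -(sumI_delta (fun j => d j * c) l); apply: sumI_ext => j.
by rewrite /axis; case: eqP => _; ring.
Qed.

Lemma norm1_axis n (l : 'I_n) c : norm1 (axis l c) = Rabs c.
Proof.
rewrite /norm1 -(sumI_delta (fun=> Rabs c) l); apply: sumI_ext => j.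
by rewrite /axis; case: eqP => _ //; rewrite Rabs_R0.
Qed.

(* Peel off one coordinate at a time: [x = 1/2 (2 x_l e_l) + 1/2 (2 (x - x_l e_l))]. *)
Lemma convex_bounded_above n (F : vec n -> R) (s : seq 'I_n) :
  convex_fun F -> forall r, 0 < r -> exists M, forall x, box r x ->
    (forall l, l \notin s -> x l = 0) -> F x <= M.
Proof.
move=> hF; elim: s => [|l s IH] r r0.
  exists (F (fun _ => 0)) => x _ hx; right; congr F; apply: vec_ext => l; exact: hx.
have [M HM] := IH (2 * r) ltac:(lra).
exists (Rabs (F (axis l (2 * r))) + Rabs (F (axis l (- (2 * r)))) + Rabs M) => x bx hx.
have seg c : Rabs c <= 2 * r ->
    F (axis l c) <= Rabs (F (axis l (2 * r))) + Rabs (F (axis l (- (2 * r)))).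
  move=> hc; pose t := (c + 2 * r) / (4 * r).
  have ht : 0 <= t <= 1.
    split.
      by apply: Rdiv_ge0; move: hc; split_Rabs; lra.
    by apply: (Rmult_le_reg_r (4 * r)); rewrite /t; [lra | field_simplify; move: hc; split_Rabs; lra].
  have -> : axis l c = vadd (vscale t (axis l (2 * r))) (vscale (1 - t) (axis l (- (2 * r)))).
    apply: vec_ext => j; rewrite /vadd /vscale /axis /t; case: eqP => _; last ring.
    by field; lra.
  have := hF (axis l (2 * r)) (axis l (- (2 * r))) t ht.
  have := Rle_abs (F (axis l (2 * r))); have := Rle_abs (F (axis l (- (2 * r)))).
  by have := Rabs_pos (F (axis l (2 * r))); have := Rabs_pos (F (axis l (- (2 * r)))); nra.
pose x' : vec n := fun j => if j == l then 0 else 2 * x j.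
have Hx' : F x' <= M.
  apply: HM => j; rewrite /x'; case: eqP => [_|jl].
  - by rewrite Rabs_R0; lra.
  - by rewrite Rabs_mult (Rabs_pos_eq 2); move: (bx j); lra.
  - by [].
  - by move=> js; rewrite hx ?inE ?negb_or ?js ?andbT; [ring | apply/eqP].
have Hl := seg (2 * x l) ltac:(rewrite Rabs_mult (Rabs_pos_eq 2); move: (bx l); lra).
have -> : x = vadd (vscale (1 / 2) (axis l (2 * x l))) (vscale (1 - 1 / 2) x').
  apply: vec_ext => j; rewrite /vadd /vscale /axis /x'; case: eqP => [->|_]; field.
have := hF (axis l (2 * x l)) x' (1 / 2) ltac:(lra); have := Rle_abs M.
have := Rabs_pos (F (axis l (2 * r))); have := Rabs_pos (F (axis l (- (2 * r)))).
have := Rabs_pos M.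
by move: Hl Hx'; lra.
Qed.

(** The lower bound follows from the upper one by reflection: the origin is the midpoint of [x] and
    [- x], so [F x] is at least twice the value at 0 minus [F (- x)]. *)
Lemma convex_bounded n (F : vec n -> R) r :
  convex_fun F -> exists M, 0 <= M /\ forall x, box r x -> Rabs (F x) <= M.
Proof.
move=> hF; have r0 : 0 < Rabs r + 1 by move: (Rabs_pos r); lra.
have [M HM] := convex_bounded_above (enum 'I_n) hF r0.
have ub x : box r x -> F x <= M.
  move=> bx; apply: HM => l; last by rewrite mem_enum.
  by move: (bx l) (Rle_abs r); lra.
exists (Rabs M + 2 * Rabs (F (fun _ => 0))); split.
  by move: (Rabs_pos M) (Rabs_pos (F (fun _ => 0))); lra.
move=> x bx; have h1 := ub x bx.
have h2 : F (vscale (-1) x) <= M.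
  by apply: ub => l; rewrite /vscale; move: (bx l); split_Rabs; lra.
have := hF x (vscale (-1) x) (1 / 2) ltac:(lra).
have -> : vadd (vscale (1 / 2) x) (vscale (1 - 1 / 2) (vscale (-1) x)) = (fun _ => 0).
  by apply: vec_ext => l; rewrite /vadd /vscale; field.
by move: h1 h2; split_Rabs; lra.
Qed.

Definition lipschitz_on_box n (r L : R) (F : vec n -> R) : Prop :=
  forall x y, box r x -> box r y -> Rabs (F x - F y) <= L * norm1 (vsub x y).

Lemma norm1_vsubC n (u v : vec n) : norm1 (vsub u v) = norm1 (vsub v u).
Proof. by apply: sumI_ext => l; apply: Rabs_minus_sym. Qed.

Lemma lipschitz_on_box_le n r L L' (F : vec n -> R) :
  L <= L' -> lipschitz_on_box r L F -> lipschitz_on_box r L' F.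
Proof.
move=> h H x y bx bY; apply: Rle_trans (H x y bx bY) _.
by apply: Rmult_le_compat_r => //; apply: norm1_ge0.
Qed.

(** Prolong the segment from [x] through [y] to a point [z] beyond [y], still in the box of radius
    [r + 1]. Then [y] is a convex combination of [z] and [x] in which [z] has weight [d / (1 + d)],
    at most the distance [d], and [F] oscillates by at most [2 * M] on the larger box. *)
Lemma convex_lipschitz n (F : vec n -> R) r :
  convex_fun F -> exists L, lipschitz_on_box r L F.
Proof.
move=> hF; have [M [M0 HM]] := convex_bounded (r + 1) hF.
suff one x y : box r x -> box r y -> F y - F x <= 2 * M * norm1 (vsub x y).
  exists (2 * M) => x y bx bY; apply: Rabs_le; move: (one x y bx bY) (one y x bY bx).
  by rewrite (norm1_vsubC y x); lra.
move=> bx bY; set d := norm1 _.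
case: (Rle_lt_or_eq_dec 0 d (norm1_ge0 _)) => [d0|d0]; last first.
  have -> : x = y.
    apply: vec_ext => l; have := norm1_coord (vsub x y) l; rewrite -/d -d0 /vsub.
    by split_Rabs; lra.
  by rewrite -d0; lra.
pose z : vec n := fun l => y l + (y l - x l) / d.
have bz : box (r + 1) z.
  move=> l; apply: Rle_trans (Rabs_triang _ _) _; apply: Rplus_le_compat; first exact: bY.
  rewrite /Rdiv Rabs_mult (Rabs_pos_eq (/ d)); last by left; apply: Rinv_0_lt_compat.
  apply: (Rmult_le_reg_r d) => //; rewrite Rmult_assoc Rinv_l; last lra.
  by have := norm1_coord (vsub x y) l; rewrite -/d /vsub Rabs_minus_sym; lra.
have bx' : box (r + 1) x by move=> l; move: (bx l); lra.
have ht : 0 <= d / (1 + d) <= 1.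
  split; first by apply: Rdiv_ge0; lra.
  by apply: (Rmult_le_reg_r (1 + d)); [lra | field_simplify; lra].
have td : d / (1 + d) <= d.
  by apply: (Rmult_le_reg_r (1 + d)); [lra | field_simplify; [nra | lra]].
have := hF z x _ ht.
have -> : vadd (vscale (d / (1 + d)) z) (vscale (1 - d / (1 + d)) x) = y.
  by apply: vec_ext => l; rewrite /vadd /vscale /z; field; lra.
set t := d / (1 + d) in ht td *.
have hz := HM z bz; have hx := HM x bx'.
have : t * (F z - F x) <= t * (2 * M).
  by apply: Rmult_le_compat_l; [lra | move: hz hx; split_Rabs; lra].
have : t * (2 * M) <= d * (2 * M) by apply: Rmult_le_compat_r; lra.
by lra.
Qed.

(** Test the subgradient inequality at [z] shifted by plus and minus a unit vector, which is why the
    Lipschitz bound is taken on radius [r + 1]. *)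
Lemma subgrad_bounded n (F : vec n -> R) r L z d l :
  lipschitz_on_box (r + 1) L F -> box r z -> is_subgrad F z d -> Rabs (d l) <= L.
Proof.
move=> lip bz sub.
have key c : Rabs c = 1 -> d l * c <= L.
  move=> hc.
  have := sub (vadd z (axis l c)).
  have -> : vsub (vadd z (axis l c)) z = axis l c.
    by apply: vec_ext => j; rewrite /vsub /vadd; ring.
  have bz' : box (r + 1) z by move=> j; move: (bz j); lra.
  have bw : box (r + 1) (vadd z (axis l c)).
    move=> j; rewrite /vadd; apply: Rle_trans (Rabs_triang _ _) _.
    apply: Rplus_le_compat; first exact: bz.
    by rewrite /axis; case: eqP => _; rewrite ?Rabs_R0; lra.
  have := lip _ _ bw bz'.
  have -> : vsub (vadd z (axis l c)) z = axis l c.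
    by apply: vec_ext => j; rewrite /vsub /vadd; ring.
  by rewrite norm1_axis hc dot_axis; split_Rabs; lra.
apply: Rabs_le; by have := key 1 ltac:(split_Rabs; lra); have := key (-1) ltac:(split_Rabs; lra); lra.
Qed.

Lemma compact_in_box n (X : vec n -> Prop) : compact_set X -> exists r, forall x, X x -> box r x.
Proof.
move=> hc; apply: NNPP => hn.
have unb (k : nat) : {x | X x /\ INR k < norm1 x}.
  apply: constructive_indefinite_description; apply: NNPP => h; apply: hn.
  exists (INR k) => x Xx l; apply: Rle_trans (norm1_coord x l) _.
  by apply: Rnot_lt_le => hlt; apply: h; exists x.
have [phi [x [hphi [_ hcv]]]] := hc (fun k => proj1_sig (unb k)) (fun k => proj1 (proj2_sig (unb k))).
have [K HK] := vnorm_cv0_norm1_cv0 hcv Rlt_0_1.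
have phige := increasing_ge_id hphi.
have [k [hk1 hk2]] : exists k, (K <= k)%coq_nat /\ norm1 x + 1 < INR k.
  have [k0 hk0] := INR_unbounded (norm1 x + 1).
  exists (k0 + K)%nat; split; first by apply/leP; apply: leq_addl.
  by rewrite plus_INR; move: (pos_INR K); lra.
have h1 := HK k hk1; rewrite /R_dist Rminus_0_r Rabs_pos_eq in h1; last exact: norm1_ge0.
have h2 := proj2 (proj2_sig (unb (phi k))).
set y := proj1_sig _ in h1 h2.
have h3 : norm1 y <= norm1 (vsub y x) + norm1 x.
  rewrite /norm1 -sumI_add; apply: sumI_le => l; rewrite /vsub.
  by apply: Rle_trans (Rabs_triang _ _); right; congr Rabs; ring.
have h4 : INR k <= INR (phi k) by apply: le_INR; apply/leP.
by lra.
Qed.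

Lemma convex_combination n p (X : vec n -> Prop) (w : 'I_p -> R) (x : 'I_p -> vec n) :
  convex_set X -> (forall j, X (x j)) -> (forall j, 0 <= w j) -> sumI w = 1 ->
  X (vsum (fun j => vscale (w j) (x j))).
Proof.
move=> hX Xx w0 w1.
(* Dropping a point destroys total weight 1, so the induction runs over arbitrary positive totals,
   normalised afterwards. *)
suff H q (v : 'I_q -> R) (y : 'I_q -> vec n) :
    (forall j, X (y j)) -> (forall j, 0 <= v j) -> 0 < sumI v ->
    X (vscale (/ sumI v) (vsum (fun j => vscale (v j) (y j)))).
  have := H p w x Xx w0; rewrite w1 => /(_ Rlt_0_1).
  congr X; apply: vec_ext => l; rewrite /vscale Rinv_1; ring.
elim: q v y => [|q IH] v y Xy v0 vpos; first by move: vpos; rewrite sumI_ord0; lra.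
have v'0 : 0 <= sumI (fun j : 'I_q => v (lift ord0 j)) by apply: sumI_ge0.
rewrite sumI_recl in vpos *; set s := sumI _ in vpos v'0 *.
set c := v ord0 in vpos *; have c0 : 0 <= c := v0 ord0.
case: (Rle_lt_or_eq_dec 0 s v'0) => hs.
  have ht : 0 <= c / (c + s) <= 1.
    split; first by apply: Rdiv_ge0.
    by apply: (Rmult_le_reg_r (c + s)); [lra | field_simplify; lra].
  have := hX _ _ _ (Xy ord0) (IH _ _ (fun j => Xy (lift ord0 j)) (fun j => v0 _) hs) ht.
  congr X; apply: vec_ext => l; rewrite /vadd /vscale /vsum sumI_recl -/s -/c.
  by field; lra.
have v00 j : v (lift ord0 j) = 0.
  have := @sumI_term _ (fun j : 'I_q => v (lift ord0 j)) j (fun j => v0 _); rewrite -/s -hs.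
  by move: (v0 (lift ord0 j)); lra.
have -> : vscale (/ (c + s)) (vsum (fun j => vscale (v j) (y j))) = y ord0; last exact: Xy.
apply: vec_ext => l; rewrite /vscale /vsum sumI_recl sumI_eq0; last by move=> j; rewrite v00; ring.
by rewrite -hs -/c; field; lra.
Qed.

Lemma dot_vsub n (u v : vec n) : dot (vsub u v) (vsub u v) = dot u u - 2 * dot u v + dot v v.
Proof.
rewrite /dot -sumI_scal -sumI_sub -sumI_add; apply: sumI_ext => l; rewrite /vsub; ring.
Qed.

Lemma dot_scaler n c (u v : vec n) : dot u (vscale c v) = c * dot u v.
Proof. by rewrite /dot -sumI_scal; apply: sumI_ext => l; rewrite /vscale; ring. Qed.

Lemma dot_scalel n c (u v : vec n) : dot (vscale c u) v = c * dot u v.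
Proof. by rewrite /dot -sumI_scal; apply: sumI_ext => l; rewrite /vscale; ring. Qed.

Lemma dot_addl n (u v w : vec n) : dot (vadd u v) w = dot u w + dot v w.
Proof. by rewrite /dot -sumI_add; apply: sumI_ext => l; rewrite /vadd; ring. Qed.

Lemma dot_vsuml n p (F : 'I_p -> vec n) w : dot (vsum F) w = sumI (fun j => dot (F j) w).
Proof.
by rewrite /dot sumI_exch; apply: sumI_ext => l; rewrite /vsum sumI_scalr.
Qed.

(** Moving from [p] a little towards [w] stays in [X] and cannot come closer to [z]; this yields the
    obtuse angle [q <= 0], and expanding the square around [p] finishes. *)
Lemma proj_contracts n (X : vec n -> Prop) z p w : convex_set X -> is_proj X z p -> X w ->
  dot (vsub p w) (vsub p w) <= dot (vsub z w) (vsub z w).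
Proof.
move=> hX [Xp hp] Xw.
pose q := dot (vsub z p) (vsub w p); pose D := dot (vsub w p) (vsub w p).
have D0 : 0 <= D by apply: dot_ge0.
have key t : 0 < t <= 1 -> 2 * q <= t * D.
  move=> ht; have := hp _ (hX w p t Xw Xp ltac:(lra)).
  have -> : vsub z (vadd (vscale t w) (vscale (1 - t) p)) = vsub (vsub z p) (vscale t (vsub w p)).
    by apply: vec_ext => l; rewrite /vsub /vadd /vscale; ring.
  move=> h; have h2 := pow_incr _ _ 2 (conj (vnorm_ge0 _) h).
  rewrite !vnorm_sqr (dot_vsub (vsub z p)) !dot_scaler dot_scalel -/q -/D in h2.
  by apply: (Rmult_le_reg_l t); nra.
have q0 : q <= 0.
  apply: Rnot_lt_le => qpos.
  (* At this [t] one has [t * D <= q], so [key] would give [2 * q <= q]. *)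
  have t01 : 0 < q / (D + q) <= 1.
    split; first by apply: Rdiv_lt_0_compat; lra.
    by apply: (Rmult_le_reg_r (D + q)); [lra | field_simplify; lra].
  have := key _ t01; have : q / (D + q) * D <= q; last by lra.
  by apply: (Rmult_le_reg_r (D + q)); [lra | field_simplify; [nra | lra]].
have -> : dot (vsub p w) (vsub p w) = D.
  by apply: sumI_ext => l; rewrite /vsub; ring.
have -> : vsub z w = vsub (vsub z p) (vsub w p).
  by apply: vec_ext => l; rewrite /vsub; ring.
by rewrite (dot_vsub (vsub z p)) -/q -/D; have := dot_ge0 (vsub z p); lra.
Qed.

(** [v] itself competes in the projection of [v - d], so the projection moves by at most the size of
    [d] again. *)
Lemma proj_close n (X : vec n -> Prop) v d p l : is_proj X (vsub v d) p -> X v ->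
  Rabs (p l - v l) <= 2 * norm1 d.
Proof.
move=> [_ hp] Xv; have h := hp v Xv.
have hd : vnorm (vsub (vsub v d) v) <= norm1 d.
  apply: Rle_trans (vnorm_le_norm1 _) _; right; apply: sumI_ext => j.
  by rewrite /vsub -Rabs_Ropp; congr Rabs; ring.
have hc : Rabs (v l - d l - p l) <= vnorm (vsub (vsub v d) p) := vnorm_coord _ l.
by move: hc (norm1_coord d l) h hd; split_Rabs; lra.
Qed.

(** * Exact penalty *)

Lemma Rabs_dot n (u v : vec n) : Rabs (dot u v) <= norm1 u * norm1 v.
Proof.
apply: Rle_trans (sumI_Rabs _) _; rewrite {1}/norm1 -sumI_scalr; apply: sumI_le => l.
rewrite Rabs_mult; apply: Rmult_le_compat_l (Rabs_pos _) (norm1_coord _ _).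
Qed.

Lemma dot_addr n (u v w : vec n) : dot w (vadd u v) = dot w u + dot w v.
Proof. by rewrite /dot -sumI_add; apply: sumI_ext => l; rewrite /vadd; ring. Qed.

Lemma norm1_add n (u v : vec n) : norm1 (vadd u v) <= norm1 u + norm1 v.
Proof. by rewrite /norm1 -sumI_add; apply: sumI_le => l; apply: Rabs_triang. Qed.

Lemma norm1_scale n c (u : vec n) : norm1 (vscale c u) = Rabs c * norm1 u.
Proof. by rewrite /norm1 -sumI_scal; apply: sumI_ext => l; apply: Rabs_mult. Qed.

(** On a linear subspace [D], a value of the linear map with rows [A l] has a preimage in [D] of
    comparable size. Induction on the rows avoids bases and compactness: the preimage for the other
    rows is corrected along one direction that only the new row sees. *)
Lemma bounded_preimage n nu (A : 'I_nu -> vec n) (D : vec n -> Prop) :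
  D (fun _ => 0) -> (forall u v c, D u -> D v -> D (vadd u (vscale c v))) ->
  exists C, 0 <= C /\ forall u, D u -> exists d, [/\ D d,
    forall l, dot (A l) d = dot (A l) u & norm1 d <= C * sumI (fun l => Rabs (dot (A l) u))].
Proof.
move=> D0 Dlin; elim: nu A => [|nu IH] A.
  exists 0; split; first lra.
  move=> u _; exists (fun _ => 0); split=> //; first by case.
  by rewrite /norm1 sumI_eq0; [lra | move=> l; apply: Rabs_R0].
have [C [C0 HC]] := IH (fun l => A (lift ord0 l)).
have ordcase (P : 'I_nu.+1 -> Prop) : P ord0 -> (forall l : 'I_nu, P (lift ord0 l)) -> forall l, P l.
  by move=> P0 PS l; case: (unliftP ord0 l) => [j ->|->].
have S0 u : 0 <= sumI (fun l : 'I_nu => Rabs (dot (A (lift ord0 l)) u)).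
  by apply: sumI_ge0 => l; apply: Rabs_pos.
(* If no such [e] exists, the other rows determine row [ord0] on [D]: [d - u] is annihilated by
   them, hence by it too, and [d] needs no correction. *)
case: (classic (exists e, [/\ D e, forall l : 'I_nu, dot (A (lift ord0 l)) e = 0 & dot (A ord0) e <> 0])); last first.
  move=> hn; exists C; split=> // u Du; have [d [Dd hd nd]] := HC u Du.
  exists d; split=> //; last first.
    rewrite sumI_recl; apply: Rle_trans nd _; apply: Rmult_le_compat_l => //.
    by have := Rabs_pos (dot (A ord0) u); lra.
  apply: ordcase => //; apply: NNPP => hne; apply: hn.
  exists (vadd d (vscale (-1) u)); split; first exact: Dlin.
    by move=> l; rewrite dot_addr dot_scaler hd; ring.
  by rewrite dot_addr dot_scaler; lra.
move=> [e [De he e0]].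
pose q := norm1 e / Rabs (dot (A ord0) e).
have ae : 0 < Rabs (dot (A ord0) e) by apply: Rabs_pos_lt.
have q0 : 0 <= q by apply: Rdiv_ge0 => //; apply: norm1_ge0.
pose c := norm1 (A ord0); have c0 : 0 <= c by apply: norm1_ge0.
(* [q] is the length of the correction per unit of defect in row [ord0]; that defect is at most the
   row value at [u] plus [c] times the norm of [d]. *)
exists (C + (1 + c * C) * q); split.
  by apply: Rplus_le_le_0_compat => //; apply: Rmult_le_pos => //; nra.
move=> u Du; have [d [Dd hd nd]] := HC u Du.
pose t := (dot (A ord0) u - dot (A ord0) d) / dot (A ord0) e.
exists (vadd d (vscale t e)); split; first exact: Dlin.
  apply: ordcase => [|l]; rewrite dot_addr dot_scaler.
    by rewrite /t; field.
  by rewrite hd he; ring.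
apply: Rle_trans (norm1_add _ _) _; rewrite norm1_scale sumI_recl.
set S := sumI _ in nd *; have {}S0 : 0 <= S := S0 u.
set a := Rabs (dot (A ord0) u); have a0 : 0 <= a by apply: Rabs_pos.
have -> : Rabs t * norm1 e = Rabs (dot (A ord0) u - dot (A ord0) d) * q.
  by rewrite /t /q /Rdiv Rabs_mult Rabs_inv; field; lra.
have hd0 : Rabs (dot (A ord0) u - dot (A ord0) d) <= a + c * (C * S).
  have := Rabs_dot (A ord0) d; rewrite -/c => h.
  have : c * norm1 d <= c * (C * S) by apply: Rmult_le_compat_l.
  by rewrite /a; move: h; split_Rabs; lra.
have h1 : Rabs (dot (A ord0) u - dot (A ord0) d) * q <= (a + c * (C * S)) * q.
  exact: Rmult_le_compat_r.
have h2 : 0 <= C * a by apply: Rmult_le_pos.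
have h3 : 0 <= q * S by apply: Rmult_le_pos.
have h4 := Rmult_le_pos _ _ (Rmult_le_pos _ _ (Rmult_le_pos _ _ c0 C0) q0) a0.
by nra.
Qed.

Lemma aff_comb_cat n (l l' : seq (R * vec n)) :
  aff_comb (l ++ l') = vadd (aff_comb l) (aff_comb l').
Proof.
apply: vec_ext => j; elim: l => [|[c p] l IH]; first by rewrite /vadd /=; ring.
by rewrite /= /vadd IH /vadd; ring.
Qed.

Lemma coef_sum_cat n (l l' : seq (R * vec n)) : coef_sum (l ++ l') = coef_sum l + coef_sum l'.
Proof. by elim: l => [|[c p] l IH] /=; rewrite ?IH; ring. Qed.

Definition scale_comb n c (l : seq (R * vec n)) := [seq (c * q.1, q.2) | q <- l].

Lemma aff_comb_scale n c (l : seq (R * vec n)) :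
  aff_comb (scale_comb c l) = vscale c (aff_comb l).
Proof.
apply: vec_ext => j; elim: l => [|[d p] l IH]; first by rewrite /vscale /=; ring.
by rewrite /= /vadd IH /vscale; ring.
Qed.

Lemma coef_sum_scale n c (l : seq (R * vec n)) : coef_sum (scale_comb c l) = c * coef_sum l.
Proof. by elim: l => [|[d p] l IH] /=; rewrite ?IH; ring. Qed.

Lemma aff_hull_in n (X : vec n -> Prop) x : X x -> aff_hull X x.
Proof.
move=> Xx; exists [:: (1, x)]; split; first by constructor.
split; first by rewrite /=; ring.
by apply: vec_ext => l; rewrite /= /vadd /vscale; ring.
Qed.

(** The directions of the affine hull form a linear space: appending [xt] with coefficient [- c]
    restores the coefficient sum 1. *)
Lemma aff_hull_direction n (X : vec n -> Prop) xt u v c : X xt ->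
  aff_hull X (vadd xt u) -> aff_hull X (vadd xt v) ->
  aff_hull X (vadd xt (vadd u (vscale c v))).
Proof.
move=> Xt [l1 [X1 [c1 e1]]] [l2 [X2 [c2 e2]]].
exists (l1 ++ scale_comb c l2 ++ [:: (- c, xt)]); split.
  apply/List.Forall_app; split=> //; apply/List.Forall_app; split; last by constructor.
  by elim: {c2 e2} l2 X2 => [|[d p] l IH] h; [constructor | inversion h; constructor => //; apply: IH].
split; first by rewrite !coef_sum_cat coef_sum_scale c1 c2 /=; ring.
rewrite !aff_comb_cat aff_comb_scale -e1 -e2.
by apply: vec_ext => j; rewrite /= /vadd /vscale; ring.
Qed.

Section Penalty.
Variables (n m nu : nat) (X : vec n -> Prop).
Variables (g : 'I_m -> vec n -> R) (A : 'I_nu -> vec n) (b : 'I_nu -> R).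

Definition ineq_violation (x : vec n) : R := sumI (fun l => Rmax 0 (g l x)).
Definition eq_violation (x : vec n) : R := sumI (fun l => Rabs (haff A b l x)).
Definition violation (x : vec n) : R := ineq_violation x + eq_violation x.

Lemma ineq_violation_ge0 x : 0 <= ineq_violation x.
Proof. by apply: sumI_ge0 => l; apply: Rmax_l. Qed.

Lemma eq_violation_ge0 x : 0 <= eq_violation x.
Proof. by apply: sumI_ge0 => l; apply: Rabs_pos. Qed.

Lemma violation_ge0 x : 0 <= violation x.
Proof. by move: (ineq_violation_ge0 x) (eq_violation_ge0 x); rewrite /violation; lra. Qed.

Lemma violation_convex : (forall l, convex_fun (g l)) -> convex_fun violation.
Proof.
move=> hg; apply: convex_add; apply: convex_sumI => l.
  exact: convex_pos_part.
exact: convex_abs_haff.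
Qed.

Lemma violation_eq0 x : violation x = 0 <-> (forall l, g l x <= 0) /\ (forall l, haff A b l x = 0).
Proof.
have gi := ineq_violation_ge0 x; have he := eq_violation_ge0 x.
split=> [h0|[hg hh]].
  split=> l.
    have := @sumI_term _ (fun l => Rmax 0 (g l x)) l (fun l => Rmax_l _ _).
    by have := Rmax_r 0 (g l x); move: h0; rewrite /violation -/(ineq_violation x); lra.
  have := @sumI_term _ (fun l => Rabs (haff A b l x)) l (fun l => Rabs_pos _).
  by move: h0; rewrite /violation -/(eq_violation x); split_Rabs; lra.
rewrite /violation /ineq_violation /eq_violation !sumI_eq0; first lra.
  by move=> l; rewrite hh Rabs_R0.
by move=> l; apply: Rmax_left.
Qed.

(** [bounded_preimage] on the directions of the affine hull gives a short [d] with the same equality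
    residual as [x]. Relative interiority allows stepping from [xt] against [d] by the fixed length
    [eps / 2] to [z], where the residual is a negative multiple of that of [x]; the weight
    [w / (w + eps / 2)] makes the two cancel and is small when [d] is short. *)
Lemma equality_error_bound :
  (exists xt, rel_interior X xt /\ (forall l, haff A b l xt = 0)) ->
  exists C, 0 <= C /\ forall x, X x -> exists t z, [/\ X z, 0 <= t <= 1, t <= C * eq_violation x &
    forall l, haff A b l (vadd (vscale t z) (vscale (1 - t) x)) = 0].
Proof.
move=> [xt [[Xt [eps [eps0 hint]]] ht]].
pose D d := aff_hull X (vadd xt d).
have D0 : D (fun _ => 0).
  have -> : D (fun _ => 0) = aff_hull X xt; last exact: aff_hull_in.
  by congr aff_hull; apply: vec_ext => l; rewrite /vadd; ring.
have Dlin u v c : D u -> D v -> D (vadd u (vscale c v)) by apply: aff_hull_direction.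
have [C [C0 HC]] := @bounded_preimage n nu A D D0 Dlin.
have e2 : 0 < eps / 2 by lra.
exists (C / (eps / 2)); split; first exact: Rdiv_ge0.
move=> x Xx.
have Du : D (vsub x xt).
  have -> : D (vsub x xt) = aff_hull X x; last exact: aff_hull_in.
  by congr aff_hull; apply: vec_ext => l; rewrite /vadd /vsub; ring.
have [d [Dd hd nd]] := HC _ Du.
have hAu l : dot (A l) (vsub x xt) = haff A b l x.
  have -> : dot (A l) (vsub x xt) = dot (A l) x - dot (A l) xt; last by move: (ht l); rewrite /haff; lra.
  by rewrite /dot -sumI_sub; apply: sumI_ext => j; rewrite /vsub; ring.
have {}nd : norm1 d <= C * eq_violation x.
  by rewrite /eq_violation -(sumI_ext (fun l => f_equal Rabs (hAu l))).
case: (Rle_lt_or_eq_dec 0 _ (norm1_ge0 d)) => hd0; last first.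
  (* With [d = 0] the point [x] already satisfies the equalities; [xt] only fills the place of
     [z]. *)
  exists 0, xt; split=> //; first lra.
    by apply: Rmult_le_pos (eq_violation_ge0 x); apply: Rdiv_ge0.
  have d0 : d = (fun _ => 0).
    by apply: vec_ext => l; have := norm1_coord d l; rewrite -hd0; split_Rabs; lra.
  move=> l; rewrite haff_affine ht -hAu -hd d0.
  have -> : dot (A l) (fun _ => 0) = 0 by apply: sumI_eq0 => j; ring.
  ring.
set w := norm1 d in nd hd0.
pose c := - (eps / 2 / w).
have cw : Rabs c * w = eps / 2.
  by rewrite /c Rabs_Ropp Rabs_pos_eq; [field; lra | apply: Rdiv_ge0; lra].
exists (w / (w + eps / 2)), (vadd xt (vscale c d)); split.
- apply: hint.
    have := Dlin _ _ c D0 Dd; congr aff_hull; apply: vec_ext => l; rewrite /vadd; ring.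
  apply: Rle_lt_trans (vnorm_le_norm1 _) _.
  have -> : vsub (vadd xt (vscale c d)) xt = vscale c d.
    by apply: vec_ext => l; rewrite /vsub /vadd; ring.
  by rewrite norm1_scale -/w cw; lra.
- split; first by apply: Rdiv_ge0; lra.
  by apply: (Rmult_le_reg_r (w + eps / 2)); [lra | field_simplify; lra].
- apply: Rle_trans (_ : w / (eps / 2) <= _).
    apply: Rmult_le_compat_l; first lra.
    by apply: Rinv_le_contravar; lra.
  have -> : C / (eps / 2) * eq_violation x = C * eq_violation x / (eps / 2) by field; lra.
  by apply: Rmult_le_compat_r => //; left; apply: Rinv_0_lt_compat.
- move=> l; rewrite haff_affine.
  have -> : haff A b l (vadd xt (vscale c d)) = c * haff A b l x.
    by rewrite /haff dot_addr dot_scaler hd hAu; move: (ht l); rewrite /haff; lra.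
  by rewrite /c; field; lra.
Qed.

(* Moving from [x] first onto the affine subspace (towards a relative interior point), then into
   the feasible set (towards a Slater point), costs [F] at most a multiple of the violation. *)
Lemma exact_penalty (F : vec n -> R) r p :
  convex_set X -> (forall x, X x -> box r x) -> slater X g A b ->
  (forall l, convex_fun (g l)) -> convex_fun F ->
  (forall x, feasible X g A b x -> p <= F x) ->
  exists c, 0 <= c /\ forall x, X x -> p <= F x + c * violation x.
Proof.
move=> hX hbox [[xb [Xb [gb hb]]] hri] hg hF hp.
have [C [C0 HC]] := equality_error_bound hri.
have [M [M0 HM]] := convex_bounded r hF.
have hi : convex_fun ineq_violation by apply: convex_sumI => l; apply: convex_pos_part.
have [Mg [Mg0 HMg]] := convex_bounded r hi.
(* [K] is an inverse of the Slater margin, common to all inequality constraints. *)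
have [K [K0 HK]] : exists K, 0 <= K /\ forall l, 1 <= K * (- g l xb).
  apply: (@uniform_bound _ (fun l K => 1 <= K * (- g l xb))).
    by move=> l K K' h1 h2; move: (gb l); nra.
  by move=> l; exists (/ (- g l xb)); move: (gb l) => h; rewrite Rinv_l; lra.
(* [2 * M] bounds the oscillation of [F] on [X]; the other factors bound the weights [t] and [s] of
   the two moves by multiples of the violation. *)
exists (2 * M * C + 2 * M * (K * (1 + Mg * C))); split.
  by apply: Rplus_le_le_0_compat; repeat apply: Rmult_le_pos; try lra; nra.
move=> x Xx.
have [t [z [Xz t01 tC hy]]] := HC x Xx.
set y := vadd _ _ in hy.
have Xy : X y by apply: hX.
have Fy : F y <= F x + 2 * M * t.
  have := hF z x t t01; rewrite -/y => h.
  have h1 := HM z (hbox z Xz); have h2 := HM x (hbox x Xx).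
  have : t * (F z - F x) <= t * (2 * M).
    by apply: Rmult_le_compat_l; [lra | move: h1 h2; split_Rabs; lra].
  by lra.
set tau := ineq_violation y.
have tau0 : 0 <= tau by apply: ineq_violation_ge0.
have tauy : tau <= ineq_violation x + Mg * t.
  have := hi z x t t01; rewrite -/y -/tau => h.
  have h1 := HMg z (hbox z Xz); have h2 := ineq_violation_ge0 x.
  have : t * ineq_violation z <= t * Mg.
    by apply: Rmult_le_compat_l; [lra | move: h1; split_Rabs; lra].
  by nra.
(* With this weight on the Slater point, its margin outweighs the remaining inequality violation, at
   most [tau] in each component. *)
pose s := K * tau / (1 + K * tau).
have Kt : 0 <= K * tau by apply: Rmult_le_pos.
have s01 : 0 <= s <= 1.
  split; first by apply: Rdiv_ge0; lra.
  by apply: (Rmult_le_reg_r (1 + K * tau)); rewrite /s; [lra | field_simplify; lra].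
have sK : s <= K * tau.
  by apply: (Rmult_le_reg_r (1 + K * tau)); rewrite /s; [lra | field_simplify; [nra | lra]].
have fz : feasible X g A b (vadd (vscale s xb) (vscale (1 - s) y)).
  split; first exact: hX.
  split=> l; last by rewrite haff_affine hb hy; ring.
  apply: Rle_trans (hg l xb y s s01) _.
  have gy : g l y <= tau.
    apply: Rle_trans (Rmax_r 0 _) _.
    exact: (@sumI_term _ (fun l => Rmax 0 (g l y)) l (fun l => Rmax_l _ _)).
  have -> : s * g l xb + (1 - s) * g l y = (g l y - tau * (K * - g l xb)) / (1 + K * tau).
    by rewrite /s; field; lra.
  have h : g l y - tau * (K * - g l xb) <= 0.
    have : tau * 1 <= tau * (K * - g l xb) by apply: Rmult_le_compat_l.
    by lra.
  have hi0 : 0 < / (1 + K * tau) by apply: Rinv_0_lt_compat; lra.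
  by rewrite /Rdiv; nra.
have Fz := hF xb y s s01.
have h1 := HM xb (hbox xb Xb); have h2 := HM y (hbox y Xy).
have h3 : s * (F xb - F y) <= s * (2 * M).
  by apply: Rmult_le_compat_l; [lra | move: h1 h2; split_Rabs; lra].
have h4 := hp _ fz.
set V := violation x.
have iV : ineq_violation x <= V by rewrite /V /violation; move: (eq_violation_ge0 x); lra.
have eV : eq_violation x <= V by rewrite /V /violation; move: (ineq_violation_ge0 x); lra.
have tV : t <= C * V by apply: Rle_trans tC _; apply: Rmult_le_compat_l.
have tauV : tau <= (1 + Mg * C) * V.
  have : Mg * t <= Mg * (C * V) by apply: Rmult_le_compat_l.
  by lra.
have sV : s <= K * ((1 + Mg * C) * V).
  by apply: Rle_trans sK _; apply: Rmult_le_compat_l.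
have h5 : 2 * M * t <= 2 * M * (C * V) by apply: Rmult_le_compat_l; lra.
have h6 : 2 * M * s <= 2 * M * (K * ((1 + Mg * C) * V)) by apply: Rmult_le_compat_l; lra.
by lra.
Qed.

End Penalty.

(** * Optimal points *)

Section Optimum.
Variables (n N m nu : nat) (f : 'I_N -> vec n -> R) (X : vec n -> Prop).
Variables (g : 'I_m -> vec n -> R) (A : 'I_nu -> vec n) (b : 'I_nu -> R).
Hypotheses (f_convex : forall i, convex_fun (f i)) (g_convex : forall l, convex_fun (g l)).
Hypotheses (X_compact : compact_set X) (X_convex : convex_set X).

Lemma ftot_convex : convex_fun (ftot f).
Proof. exact: convex_sumI. Qed.

(** At a cluster point the penalized cost with weight [kappa] is at most [p], with weight [c] at
    least [p]; since [kappa] exceeds [c], the violation vanishes. It serves both the existence of an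
    optimum and the states of an agent. *)
Lemma near_minimizers_cluster p c kappa (u : nat -> vec n) :
  (forall z, X z -> p <= ftot f z + c * violation g A b z) -> c + 1 <= kappa ->
  (forall j, X (u j)) ->
  (forall j, ftot f (u j) + kappa * violation g A b (u j) <= p + / INR j.+1) ->
  exists phi xt, [/\ forall k, (phi k < phi k.+1)%nat, feasible X g A b xt, ftot f xt = p &
    Un_cv (fun k => norm1 (vsub (u (phi k)) xt)) 0].
Proof.
move=> hpen hk Xu hu.
have [phi [xt [hphi [Xt hcv]]]] := X_compact Xu.
have {}hcv := vnorm_cv0_norm1_cv0 hcv.
have [r hbox] := compact_in_box X_compact.
have hv := violation_convex A b g_convex.
have [L hL] := convex_lipschitz r ftot_convex.
have [L' hL'] := convex_lipschitz r hv.
pose Psi z := ftot f z + kappa * violation g A b z.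
(* Passage to the limit by contradiction: the positive constant [Psi xt - p] would be dominated by a
   null sequence. *)
have Pxt : Psi xt <= p.
  apply: Rnot_lt_le => hlt.
  have bnd k : Rabs (Psi xt - p) <=
      / INR (phi k).+1 + (L + Rabs kappa * L') * norm1 (vsub (u (phi k)) xt).
    rewrite Rabs_pos_eq; last lra.
    have h1 := hL _ _ (hbox _ (Xu (phi k))) (hbox _ Xt).
    have h2 := hL' _ _ (hbox _ (Xu (phi k))) (hbox _ Xt).
    have h3 := hu (phi k).
    have h4 : kappa * (violation g A b xt - violation g A b (u (phi k))) <=
        Rabs kappa * (L' * norm1 (vsub (u (phi k)) xt)).
      apply: Rle_trans (Rle_abs _) _; rewrite Rabs_mult.
      by apply: Rmult_le_compat_l; [exact: Rabs_pos | rewrite Rabs_minus_sym].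
    rewrite Rabs_minus_sym in h1; have {}h1 := Rle_trans _ _ _ (Rle_abs _) h1.
    by rewrite /Psi; lra.
  have := @cv0_le (fun _ => Psi xt - p) _ bnd (cv0_add (cv_subseq (increasing_ge_id hphi) cv_inv_succ) (cv0_scal _ hcv)).
  move=> /(_ (Psi xt - p) ltac:(lra)) [K /(_ K (Nat.le_refl K))].
  by rewrite /R_dist Rminus_0_r Rabs_pos_eq; lra.
have v0 := violation_ge0 g A b xt.
have hx := hpen xt Xt.
have vz : violation g A b xt = 0 by move: Pxt; rewrite /Psi; nra.
exists phi, xt; split=> //; first by split=> //; apply/violation_eq0.
by move: Pxt hx; rewrite /Psi vz; lra.
Qed.

(** The exact penalty is applied to the infimum, which is any lower bound to that lemma, before it
    is known to be attained; a minimizing sequence then clusters at an optimum. *)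
Lemma exists_optimal : (exists xf, feasible X g A b xf) -> slater X g A b ->
  exists xs c, [/\ optimal f X g A b xs, 0 <= c &
    forall z, X z -> ftot f xs <= ftot f z + c * violation g A b z].
Proof.
move=> [xf hxf] hsl.
have [r hbox] := compact_in_box X_compact.
have [M [M0 HM]] := convex_bounded r ftot_convex.
have [q [hq1 hq2]] : {q | is_lub (fun v => exists z, feasible X g A b z /\ v = - ftot f z) q}.
  apply: completeness; last by exists (- ftot f xf), xf.
  exists M => v [z [[Xz _] ->]]; have := HM z (hbox z Xz); split_Rabs; lra.
have lb z : feasible X g A b z -> - q <= ftot f z.
  by move=> hz; have := hq1 (- ftot f z) (ex_intro _ z (conj hz erefl)); lra.
have [c [c0 hc]] := exact_penalty X_convex hbox hsl g_convex ftot_convex lb.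
have app (j : nat) : {z | feasible X g A b z /\ ftot f z <= - q + / INR j.+1}.
  apply: constructive_indefinite_description; apply: NNPP => hn.
  have jp : 0 < / INR j.+1 by apply: Rinv_0_lt_compat; apply: lt_0_INR; apply/ltP.
  have : q <= q - / INR j.+1; last lra.
  apply: hq2 => v [z [hz ->]]; apply: Rnot_lt_le => h; apply: hn; exists z; split=> //; lra.
have [|||phi [xt [_ ft ht _]]] :=
  @near_minimizers_cluster (- q) c (c + 1) (fun j => proj1_sig (app j)) hc; try lra.
- by move=> j; case: (proj2_sig (app j)) => -[].
- move=> j; case: (proj2_sig (app j)) => -[Xz hz] h.
  by have /violation_eq0 -> := hz; lra.
exists xt, c; split=> //; first by split=> // z /lb; rewrite ht.
by rewrite ht.
Qed.

End Optimum.

(** * The algorithm *)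

(** Jensen's inequality in each row, as nonnegativity of the weighted variance about [mi]; the
    column sums carry it over to the total. *)
Lemma sum_sqr_avg N (a : nat -> 'I_N -> 'I_N -> R) k z c :
  non_degenerate a -> balanced a ->
  sumI (fun i => (avg a k z i - c) ^ 2) <= sumI (fun i => (z i - c) ^ 2).
Proof.
move=> hnd hbal; rewrite -(sum_avg hbal k (fun i => (z i - c) ^ 2)); apply: sumI_le => i.
set mi := avg a k z i.
have : 0 <= avg a k (fun j => (z j - mi) ^ 2) i.
  by apply: avg_lb => // j; apply: pow2_ge_0.
have lin Q d K : avg a k (fun j => Q j + d * z j + K) i = avg a k Q i + d * mi + K.
  rewrite !avg_add avg_const //; congr (_ + _ + _).
  by rewrite /mi /avg -sumI_scal; apply: sumI_ext => j; ring.
rewrite (@avg_ext _ _ _ _ (fun j => (z j - c) ^ 2 + (- 2 * (mi - c)) * z j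
  + (2 * (mi - c) * c + (mi - c) ^ 2))); last by move=> j; ring.
by rewrite lin; lra.
Qed.

(** Strictly below [k]: the step length accumulated when the multipliers at time [k] are formed. At
    [k.+1] it is [s(k)], matching the products in the step-size assumption. *)
Definition step_sum (alpha : nat -> R) (k : nat) : R := sumI (fun s : 'I_k => alpha s).

Lemma step_sumS alpha k : step_sum alpha k.+1 = ssum alpha k.
Proof.
rewrite /step_sum; elim: k => [|k IH]; first by rewrite sumI_recl sumI_ord0 /=; ring.
by rewrite (@sumI_recr k.+1 alpha) IH.
Qed.

Section StepSize.
Variable alpha : nat -> R.
Hypothesis h_alpha : step_size alpha.

Lemma step_pos k : 0 < alpha k.
Proof. by case: h_alpha. Qed.

Lemma step_sum_ge0 k : 0 <= step_sum alpha k.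
Proof. by apply: sumI_ge0 => s; left; apply: step_pos. Qed.

Lemma step_square_summable : square_summable alpha.
Proof.
case: h_alpha => _ [_ [_ [h _]]].
by apply: series_cv_summable h => k; apply: pow2_ge_0.
Qed.

Lemma weighted_step_square_summable : square_summable (fun k => alpha k * (1 + step_sum alpha k)).
Proof.
apply: square_summable_shift.
have h1 := square_summable_unshift step_square_summable.
have h2 : square_summable (fun k => alpha k.+1 * ssum alpha k).
  case: h_alpha => _ [_ [_ [_ [_ [_ h]]]]].
  apply: summable_le (series_cv_summable _ h) => k; rewrite ?Rpow_mult_distr.
    by split; [apply: Rmult_le_pos; apply: pow2_ge_0 | lra].
  by apply: Rmult_le_pos; apply: pow2_ge_0.
apply: summable_le (square_summable_add h1 h2) => k; split; first exact: pow2_ge_0.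
by rewrite step_sumS; right; ring.
Qed.

End StepSize.

(** * The multiplier recursion, common to [mu] and [lam] *)

Section Multipliers.
Variables (N p : nat) (a : nat -> 'I_N -> 'I_N -> R) (alpha : nat -> R).
Variables (w : 'I_N -> nat -> 'I_p -> R) (G : 'I_N -> nat -> 'I_p -> R) (L : R).
Hypotheses (a_nondeg : non_degenerate a) (a_bal : balanced a) (a_conn : periodic_strong_conn a).
Hypothesis (h_alpha : step_size alpha).
Hypothesis w_init : forall i l, 0 <= w i 0%nat l.
Hypothesis w_step : forall i k l,
  w i k.+1 l = avg a k (fun j => w j k l) i + alpha k * G i k l.
Hypothesis G_bnd : forall i k l, 0 <= G i k l <= L.

Lemma incr_ge0 i k l : 0 <= alpha k * G i k l.
Proof. by apply: Rmult_le_pos; [left; apply: step_pos h_alpha _ | case: (G_bnd i k l)]. Qed.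

Lemma multiplier_ge0 i k l : 0 <= w i k l.
Proof.
elim: k i => [|k IH] i //; rewrite w_step.
by apply: Rplus_le_le_0_compat (incr_ge0 _ _ _); apply: avg_lb.
Qed.

(** Averaging does not raise the maximum and each step adds at most a multiple of [alpha k]. *)
Lemma multiplier_growth : exists C, 0 <= C /\ forall i k l,
  0 <= avg a k (fun j => w j k l) i <= C * (1 + step_sum alpha k).
Proof.
pose C0 := sumI (fun i => sumI (fun l => w i 0%nat l)).
have C00 : 0 <= C0 by do 2 apply: sumI_ge0 => ?; apply: w_init.
have hw k i l : w i k l <= C0 + Rabs L * step_sum alpha k.
  elim: k i => [|k IH] i.
    rewrite /step_sum sumI_ord0 Rmult_0_r Rplus_0_r.
    apply: Rle_trans (_ : sumI (fun l => w i 0%nat l) <= _).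
      exact: (@sumI_term _ (fun l => w i 0%nat l)).
    apply: (@sumI_term _ (fun i => sumI (fun l => w i 0%nat l))) => j.
    exact: sumI_ge0.
  rewrite w_step /step_sum (@sumI_recr k alpha) -/(step_sum alpha k).
  have h1 := avg_ub a_nondeg a_bal k i IH.
  have h2 : alpha k * G i k l <= alpha k * Rabs L.
    apply: Rmult_le_compat_l; first by left; apply: step_pos h_alpha _.
    by apply: Rle_trans (Rle_abs L); case: (G_bnd i k l).
  by lra.
exists (C0 + Rabs L); split; first by move: (Rabs_pos L); lra.
move=> i k l; split; first by apply: avg_lb => // j; apply: multiplier_ge0.
apply: avg_ub => // j; have := hw k j l; have := step_sum_ge0 h_alpha k; have := Rabs_pos L.
by nra.
Qed.

Lemma multiplier_spread l : square_summable (fun k => spread (fun i => w i k l)).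
Proof.
apply: (@spread_square_summable _ a a_nondeg a_bal a_conn (fun k i => w i k l) (fun k => Rabs L * alpha k)).
- by move=> k; apply: Rmult_le_pos; [apply: Rabs_pos | left; apply: step_pos h_alpha _].
- exact: square_summable_scal (step_square_summable h_alpha).
move=> k i; rewrite w_step.
have -> : forall u v, u + v - u = v by move=> u v; ring.
rewrite Rabs_pos_eq; last exact: incr_ge0.
rewrite Rmult_comm; apply: Rmult_le_compat_r; first by left; apply: step_pos h_alpha _.
by apply: Rle_trans (Rle_abs L); case: (G_bnd i k l).
Qed.

(* The network average of a multiplier is nondecreasing, and the agents reach consensus. *)
Lemma multiplier_cv M l : (forall i k, w i k l <= M) -> exists v, forall i, Un_cv (fun k => w i k l) v.
Proof.
move=> HM.
case: (classic (exists i0 : 'I_N, True)) => [[i0 _]|hN]; last first.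
  by exists 0 => i; case: hN; exists i.
have [] := growing_cv (fun k => sumI (fun i => w i k l)).
- move=> k; rewrite -(sum_avg a_bal k (fun i => w i k l)); apply: sumI_le => i.
  by rewrite w_step; move: (incr_ge0 i k l); lra.
- by exists (INR N * M) => v [k ->]; rewrite -sumI_const; apply: sumI_le.
move=> v hv; exists (/ INR N * v) => i.
have h1 : Un_cv (fun k => w i k l - / INR N * sumI (fun j => w j k l)) 0.
  apply: cv0_le (square_summable_cv0 (multiplier_spread l)) => k.
  exact: (Rabs_sub_mean (fun j => w j k l)).
have h2 : Un_cv (fun k => / INR N * sumI (fun j => w j k l)) (/ INR N * v).
  apply: (CV_mult (fun _ => / INR N)) => //.
  by move=> e e0; exists 0%nat => k _; rewrite R_dist_eq.
have := CV_plus _ _ _ _ h1 h2; rewrite Rplus_0_l; apply: Un_cv_ext => k; ring.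
Qed.

Definition multiplier_energy (gamma : R) (k : nat) : R :=
  sumI (fun i => sumI (fun l => (w i k l - gamma) ^ 2)).

(** Only the square of the increment is estimated. The product of multiplier and violation is kept
    exact, since it is to cancel against the primal step. *)
Lemma multiplier_energy_step gamma k :
  multiplier_energy gamma k.+1 <= multiplier_energy gamma k
  + 2 * alpha k * sumI (fun i => sumI (fun l => avg a k (fun j => w j k l) i * G i k l)
                             - gamma * sumI (fun l => G i k l))
  + INR N * (INR p * L ^ 2) * alpha k ^ 2.
Proof.
pose V := sumI (fun i => sumI (fun l => (avg a k (fun j => w j k l) i - gamma) ^ 2)).
have hV : V <= multiplier_energy gamma k.
  rewrite /V /multiplier_energy sumI_exch [X in _ <= X]sumI_exch; apply: sumI_le => l.
  exact: (sum_sqr_avg k (fun i => w i k l)).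
suff h : multiplier_energy gamma k.+1 <= V
  + 2 * alpha k * sumI (fun i => sumI (fun l => avg a k (fun j => w j k l) i * G i k l)
                             - gamma * sumI (fun l => G i k l))
  + INR N * (INR p * L ^ 2) * alpha k ^ 2 by lra.
rewrite /multiplier_energy /V.
have -> : INR N * (INR p * L ^ 2) * alpha k ^ 2 =
    sumI (fun i : 'I_N => sumI (fun l : 'I_p => alpha k ^ 2 * L ^ 2)).
  by rewrite !sumI_const; ring.
rewrite -sumI_scal -!sumI_add; apply: sumI_le => i.
rewrite -sumI_scal -sumI_sub -sumI_scal -!sumI_add; apply: sumI_le => l.
rewrite w_step; set u := avg _ _ _ _.
have h := G_bnd i k l.
have : alpha k ^ 2 * (G i k l) ^ 2 <= alpha k ^ 2 * L ^ 2.
  by apply: Rmult_le_compat_l; [apply: pow2_ge_0 | apply: pow_incr].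
by nra.
Qed.

Lemma multiplier_energy_ge0 gamma k : 0 <= multiplier_energy gamma k.
Proof. by do 2 apply: sumI_ge0 => ?; apply: pow2_ge_0. Qed.

Lemma multiplier_le_energy gamma i k l : w i k l <= gamma + 1 + multiplier_energy gamma k.
Proof.
have h : (w i k l - gamma) ^ 2 <= multiplier_energy gamma k.
  apply: Rle_trans (_ : sumI (fun l => (w i k l - gamma) ^ 2) <= _).
    by apply: (@sumI_term _ (fun l => (w i k l - gamma) ^ 2)) => ?; apply: pow2_ge_0.
  apply: (@sumI_term _ (fun i => sumI (fun l => (w i k l - gamma) ^ 2))) => j.
  by apply: sumI_ge0 => ?; apply: pow2_ge_0.
by have := pow2_ge_0 (w i k l - gamma - 1 / 2); lra.
Qed.

Lemma multiplier_energy_cv gamma M : (forall k, multiplier_energy gamma k <= M) ->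
  exists v, Un_cv (multiplier_energy gamma) v.
Proof.
move=> HM.
have hb l i k : w i k l <= gamma + 1 + M.
  by move: (multiplier_le_energy gamma i k l) (HM k); lra.
have hv l : {v | forall i, Un_cv (fun k => w i k l) v}.
  by apply: constructive_indefinite_description; apply: multiplier_cv (hb l).
exists (sumI (fun i : 'I_N => sumI (fun l => (proj1_sig (hv l) - gamma) ^ 2))).
apply: (@cv_sumI _ (fun i k => sumI (fun l => (w i k l - gamma) ^ 2))) => i.
apply: (@cv_sumI _ (fun l k => (w i k l - gamma) ^ 2)) => l.
have h : Un_cv (fun k => w i k l - gamma) (proj1_sig (hv l) - gamma).
  apply: (CV_minus _ (fun _ => gamma)); first exact: (proj2_sig (hv l)).
  by move=> e e0; exists 0%nat => k _; rewrite R_dist_eq.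
have := CV_mult _ _ _ _ h h.
rewrite /= Rmult_1_r; apply: Un_cv_ext => k; ring.
Qed.

End Multipliers.

(** * Primal iterates and the joint energy *)

Section Algorithm.
Variables (n N m nu : nat) (f : 'I_N -> vec n -> R) (X : vec n -> Prop).
Variables (g : 'I_m -> vec n -> R) (A : 'I_nu -> vec n) (b : 'I_nu -> R).
Variables (a : nat -> 'I_N -> 'I_N -> R) (alpha : nat -> R).
Variables (x : 'I_N -> nat -> vec n) (y : 'I_N -> nat -> R).
Variables (mu : 'I_N -> nat -> 'I_m -> R) (lam : 'I_N -> nat -> 'I_nu -> R).
Variables (df : 'I_N -> nat -> vec n) (dg : 'I_N -> nat -> 'I_m -> vec n)
          (dh : 'I_N -> nat -> 'I_nu -> vec n).

Definition mean_x i k : vec n := vsum (fun j => vscale (a k i j) (x j k)).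
Definition mean_mu i k l : R := avg a k (fun j => mu j k l) i.
Definition mean_lam i k l : R := avg a k (fun j => lam j k l) i.
Definition direction i k : vec n :=
  vadd (df i k) (vadd (vsum (fun l => vscale (mean_mu i k l) (dg i k l)))
                      (vsum (fun l => vscale (mean_lam i k l) (dh i k l)))).

Hypotheses (f_convex : forall i, convex_fun (f i)) (g_convex : forall l, convex_fun (g l)).
Hypotheses (X_compact : compact_set X) (X_convex : convex_set X).
Hypotheses (a_nondeg : non_degenerate a) (a_bal : balanced a) (a_conn : periodic_strong_conn a).
Hypothesis (h_alpha : step_size alpha).
Hypothesis x_init : forall i, X (x i 0%nat).
Hypothesis mu_init : forall i l, 0 <= mu i 0%nat l.
Hypothesis lam_init : forall i l, 0 <= lam i 0%nat l.
Hypothesis y_init : forall i, y i 1%nat = INR N * f i (x i 0%nat).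
Hypothesis df_subgrad : forall i k, is_subgrad (f i) (mean_x i k) (df i k).
Hypothesis dg_subgrad :
  forall i k l, is_subgrad (fun z => Rmax 0 (g l z)) (mean_x i k) (dg i k l).
Hypothesis dh_subgrad :
  forall i k l, is_subgrad (fun z => Rabs (haff A b l z)) (mean_x i k) (dh i k l).
Hypothesis x_step : forall i k,
  is_proj X (vsub (mean_x i k) (vscale (alpha k) (direction i k))) (x i k.+1).
Hypothesis mu_step : forall i k l,
  mu i k.+1 l = mean_mu i k l + alpha k * Rmax 0 (g l (mean_x i k)).
Hypothesis lam_step : forall i k l,
  lam i k.+1 l = mean_lam i k l + alpha k * Rabs (haff A b l (mean_x i k)).
Hypothesis y_step : forall i k, (1 <= k)%nat ->
  y i k.+1 = avg a k (fun j => y j k) i + INR N * (f i (x i k) - f i (x i k.-1)).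

Lemma x_in_X i k : X (x i k).
Proof. by case: k => // k; case: (x_step i k). Qed.

Lemma mean_x_in_X i k : X (mean_x i k).
Proof.
apply: convex_combination => // [j|j|]; first exact: x_in_X.
  exact: weight_ge0.
exact: (proj1 (a_bal k)).
Qed.

Lemma subgrads_bounded : exists L, 0 <= L /\ forall i k,
  [/\ forall j, Rabs (df i k j) <= L, forall l j, Rabs (dg i k l j) <= L
    & forall l j, Rabs (dh i k l j) <= L].
Proof.
have [r hbox] := compact_in_box X_compact.
have bm i k := hbox _ (mean_x_in_X i k).
have [L1 [L10 H1]] : exists L, 0 <= L /\ forall i, lipschitz_on_box (r + 1) L (f i).
  apply: uniform_bound => [i|i]; last exact: convex_lipschitz.
  by move=> M M'; apply: lipschitz_on_box_le.
have [L2 [L20 H2]] :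
    exists L, 0 <= L /\ forall l, lipschitz_on_box (r + 1) L (fun z => Rmax 0 (g l z)).
  apply: (@uniform_bound _ (fun l L => lipschitz_on_box (r + 1) L (fun z => Rmax 0 (g l z)))).
    by move=> l M M'; apply: lipschitz_on_box_le.
  by move=> l; apply: convex_lipschitz; apply: convex_pos_part.
have [L3 [L30 H3]] :
    exists L, 0 <= L /\ forall l, lipschitz_on_box (r + 1) L (fun z => Rabs (haff A b l z)).
  apply: (@uniform_bound _ (fun l L => lipschitz_on_box (r + 1) L (fun z => Rabs (haff A b l z)))).
    by move=> l M M'; apply: lipschitz_on_box_le.
  by move=> l; apply: convex_lipschitz; apply: convex_abs_haff.
exists (L1 + L2 + L3); split; first lra.
move=> i k; split.
- by move=> j; have := subgrad_bounded j (H1 i) (bm i k) (df_subgrad i k); lra.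
- by move=> l j; have := subgrad_bounded j (H2 l) (bm i k) (dg_subgrad i k l); lra.
- by move=> l j; have := subgrad_bounded j (H3 l) (bm i k) (dh_subgrad i k l); lra.
Qed.

Lemma constraints_bounded : exists L, forall i k,
  (forall l, 0 <= Rmax 0 (g l (mean_x i k)) <= L) /\
  (forall l, 0 <= Rabs (haff A b l (mean_x i k)) <= L).
Proof.
have [r hbox] := compact_in_box X_compact.
have [L [L0 hL]] := convex_bounded r (violation_convex A b g_convex).
exists L => i k.
have h := hL _ (hbox _ (mean_x_in_X i k)).
have hi := ineq_violation_ge0 g (mean_x i k); have he := eq_violation_ge0 A b (mean_x i k).
rewrite /violation Rabs_pos_eq in h; last lra.
split=> l; split; try exact: Rmax_l; try exact: Rabs_pos.
  have := @sumI_term _ (fun l => Rmax 0 (g l (mean_x i k))) l (fun l => Rmax_l _ _).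
  by rewrite -/(ineq_violation g (mean_x i k)); lra.
have := @sumI_term _ (fun l => Rabs (haff A b l (mean_x i k))) l (fun l => Rabs_pos _).
by rewrite -/(eq_violation A b (mean_x i k)); lra.
Qed.

Lemma direction_growth : exists C, 0 <= C /\ forall i k,
  norm1 (direction i k) <= C * (1 + step_sum alpha k).
Proof.
have [L [L0 hL]] := subgrads_bounded; have [L' hL'] := constraints_bounded.
have [C1 [C10 H1]] := multiplier_growth a_nondeg a_bal h_alpha mu_init mu_step
  (fun i k l => proj1 (hL' i k) l).
have [C2 [C20 H2]] := multiplier_growth a_nondeg a_bal h_alpha lam_init lam_step
  (fun i k l => proj2 (hL' i k) l).
have nL (d : vec n) : (forall j, Rabs (d j) <= L) -> norm1 d <= INR n * L.
  by move=> h; rewrite -sumI_const; apply: sumI_le.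
have nL0 : 0 <= INR n * L by apply: Rmult_le_pos => //; apply: pos_INR.
have sum_bound q (c : 'I_q -> R) (d : 'I_q -> vec n) M : (forall l, 0 <= c l <= M) ->
    (forall l j, Rabs (d l j) <= L) -> norm1 (vsum (fun l => vscale (c l) (d l))) <= INR q * (M * (INR n * L)).
  move=> hc hd.
  apply: Rle_trans (_ : sumI (fun l => norm1 (vscale (c l) (d l))) <= _).
    rewrite /norm1 sumI_exch; apply: sumI_le => j; exact: sumI_Rabs.
  rewrite -sumI_const; apply: sumI_le => l; rewrite norm1_scale Rabs_pos_eq; last by case: (hc l).
  apply: Rmult_le_compat; [by case: (hc l) | exact: norm1_ge0 | by case: (hc l) | exact: nL].
exists (INR n * L * (1 + INR m * C1 + INR nu * C2)); split.
  by have := pos_INR m; have := pos_INR nu => *; apply: Rmult_le_pos => //; nra.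
move=> i k; have [h1 h2 h3] := hL i k.
have s0 := step_sum_ge0 h_alpha k.
apply: Rle_trans (norm1_add _ _) _.
have := norm1_add (vsum (fun l => vscale (mean_mu i k l) (dg i k l)))
  (vsum (fun l => vscale (mean_lam i k l) (dh i k l))).
have := nL _ h1.
have := sum_bound _ _ _ _ (H1 i k) h2; have := sum_bound _ _ _ _ (H2 i k) h3.
rewrite -/(mean_lam i k) -/(mean_mu i k).
have : INR n * L <= INR n * L * (1 + step_sum alpha k) by nra.
rewrite /mean_mu /mean_lam; lra.
Qed.

(** Casts the projected step as averaging with a square-summable perturbation. *)
Lemma x_step_close : exists e, [/\ forall k, 0 <= e k, square_summable e &
  forall i k l, Rabs (x i k.+1 l - mean_x i k l) <= e k].
Proof.
have [C [C0 HC]] := direction_growth.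
exists (fun k => 2 * C * (alpha k * (1 + step_sum alpha k))); split.
- move=> k; have := step_sum_ge0 h_alpha k; have := step_pos h_alpha k => h1 h2.
  by repeat apply: Rmult_le_pos; lra.
- exact: square_summable_scal (weighted_step_square_summable h_alpha).
move=> i k l; apply: Rle_trans (proj_close l (x_step i k) (mean_x_in_X i k)) _.
rewrite norm1_scale Rabs_pos_eq; last by left; apply: step_pos h_alpha _.
have := Rmult_le_compat_l _ _ _ (Rlt_le _ _ (step_pos h_alpha k)) (HC i k).
by lra.
Qed.

Definition disagreement k : R := sumI (fun l => spread (fun i => x i k l)).

Lemma disagreement_ge0 k : 0 <= disagreement k.
Proof. by apply: sumI_ge0 => l; apply: spread_ge0. Qed.

Lemma disagreement_square_summable : square_summable disagreement.
Proof.
have [e [e0 se he]] := x_step_close.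
apply: square_summable_sumI => l.
by apply: (spread_square_summable a_nondeg a_bal a_conn e0 se) => k i; apply: he.
Qed.

Lemma norm1_mean_x_sub i j k : norm1 (vsub (mean_x i k) (x j k)) <= disagreement k.
Proof. by apply: sumI_le => l; apply: (Rabs_avg_sub a_nondeg a_bal k (fun i => x i k l)). Qed.

Lemma norm1_x_sub i j k : norm1 (vsub (x i k) (x j k)) <= disagreement k.
Proof. by apply: sumI_le => l; apply: (Rabs_spread (fun i => x i k l)). Qed.

Definition primal_energy (w : vec n) k : R := sumI (fun i => dot (vsub (x i k) w) (vsub (x i k) w)).

Lemma primal_energy_ge0 w k : 0 <= primal_energy w k.
Proof. by apply: sumI_ge0 => i; apply: dot_ge0. Qed.

(** Neither averaging nor projection increases the distance to [w]. At feasible [w] the constraint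
    terms of the subgradient inequalities vanish; scaled by the nonnegative multipliers, they leave
    the bilinear terms with a minus sign. *)
Lemma primal_energy_step : exists C, 0 <= C /\ forall w k, feasible X g A b w ->
  primal_energy w k.+1 <= primal_energy w k
  + 2 * alpha k * sumI (fun i => f i w - f i (mean_x i k)
      - sumI (fun l => mean_mu i k l * Rmax 0 (g l (mean_x i k)))
      - sumI (fun l => mean_lam i k l * Rabs (haff A b l (mean_x i k))))
  + C * (alpha k * (1 + step_sum alpha k)) ^ 2.
Proof.
have [C [C0 HC]] := direction_growth.
have [L' hL'] := constraints_bounded.
have mu0 i k l : 0 <= mean_mu i k l.
  apply: avg_lb => // j.
  exact: (multiplier_ge0 a_nondeg a_bal h_alpha mu_init mu_step (fun i k l => proj1 (hL' i k) l)).
have lam0 i k l : 0 <= mean_lam i k l.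
  apply: avg_lb => // j.
  exact: (multiplier_ge0 a_nondeg a_bal h_alpha lam_init lam_step (fun i k l => proj2 (hL' i k) l)).
exists (INR N * C ^ 2); split.
  by apply: Rmult_le_pos; [apply: pos_INR | apply: pow2_ge_0].
move=> w k [Xw [gw hw]].
have a0 := step_pos h_alpha k.
pose V := sumI (fun i => dot (vsub (mean_x i k) w) (vsub (mean_x i k) w)).
have hV : V <= primal_energy w k.
  rewrite /V /primal_energy /dot sumI_exch [X in _ <= X]sumI_exch; apply: sumI_le => l.
  apply: Rle_trans (Rle_trans _ _ _ _ (sum_sqr_avg k (fun i => x i k l) (w l) a_nondeg a_bal)) _;
    right; apply: sumI_ext => i; last by rewrite /vsub; ring.
  by rewrite -[avg a k _ i]/(mean_x i k l) /vsub; ring.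
suff h : primal_energy w k.+1 <= V
  + 2 * alpha k * sumI (fun i => f i w - f i (mean_x i k)
      - sumI (fun l => mean_mu i k l * Rmax 0 (g l (mean_x i k)))
      - sumI (fun l => mean_lam i k l * Rabs (haff A b l (mean_x i k))))
  + INR N * C ^ 2 * (alpha k * (1 + step_sum alpha k)) ^ 2 by lra.
have -> : INR N * C ^ 2 * (alpha k * (1 + step_sum alpha k)) ^ 2 =
    sumI (fun _ : 'I_N => C ^ 2 * (alpha k * (1 + step_sum alpha k)) ^ 2).
  by rewrite sumI_const; ring.
rewrite /primal_energy /V -sumI_scal -!sumI_add; apply: sumI_le => i.
apply: Rle_trans (proj_contracts X_convex (x_step i k) Xw) _.
set v := mean_x i k; set S := direction i k.
have -> : vsub (vsub v (vscale (alpha k) S)) w = vsub (vsub v w) (vscale (alpha k) S).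
  by apply: vec_ext => l; rewrite /vsub; ring.
rewrite (dot_vsub (vsub v w)) dot_scaler dot_scalel dot_scaler.
have hS : dot S S <= C ^ 2 * (1 + step_sum alpha k) ^ 2.
  rewrite -vnorm_sqr -Rpow_mult_distr; apply: pow_incr; split; first exact: vnorm_ge0.
  exact: Rle_trans (vnorm_le_norm1 _) (HC i k).
have hdot : dot (vsub v w) S = - dot S (vsub w v).
  by rewrite /dot -sumI_opp; apply: sumI_ext => l; rewrite /vsub; ring.
have hsub : dot S (vsub w v) <= f i w - f i v - sumI (fun l => mean_mu i k l * Rmax 0 (g l v))
    - sumI (fun l => mean_lam i k l * Rabs (haff A b l v)).
  rewrite /S /direction !dot_addl !dot_vsuml.
  have h1 := df_subgrad i k w; rewrite -/v in h1.
  have h2 : sumI (fun l => dot (vscale (mean_mu i k l) (dg i k l)) (vsub w v)) <=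
      sumI (fun l => - (mean_mu i k l * Rmax 0 (g l v))).
    apply: sumI_le => l; rewrite dot_scalel.
    have := dg_subgrad i k l w; rewrite -/v /= (Rmax_left 0 (g l w)) // => h.
    by have := Rmult_le_compat_l _ _ _ (mu0 i k l) h; lra.
  have h3 : sumI (fun l => dot (vscale (mean_lam i k l) (dh i k l)) (vsub w v)) <=
      sumI (fun l => - (mean_lam i k l * Rabs (haff A b l v))).
    apply: sumI_le => l; rewrite dot_scalel.
    have := dh_subgrad i k l w; rewrite -/v /= hw Rabs_R0 => h.
    by have := Rmult_le_compat_l _ _ _ (lam0 i k l) h; lra.
  by move: h2 h3; rewrite !sumI_opp; lra.
rewrite hdot.
have h1 := Rmult_le_compat_l _ _ _ (Rlt_le _ _ a0) hsub.
have h2 := Rmult_le_compat_l _ _ _ (pow2_ge_0 (alpha k)) hS.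
by lra.
Qed.

Definition energy gamma w k : R :=
  primal_energy w k + multiplier_energy mu gamma k + multiplier_energy lam gamma k.

(* The multiplier terms of the primal and dual steps cancel agent by agent. *)
Lemma energy_step gamma i0 : 0 <= gamma -> exists r, summable r /\
  forall w k, feasible X g A b w -> energy gamma w k.+1 <= energy gamma w k + r k
    - 2 * (alpha k * (ftot f (x i0 k) + INR N * gamma * violation g A b (x i0 k) - ftot f w)).
Proof.
move=> gamma0.
have [C [C0 HC]] := primal_energy_step.
have [L' hL'] := constraints_bounded.
have [r hbox] := compact_in_box X_compact.
have [L [L0 HL]] : exists L, 0 <= L /\
    forall i, lipschitz_on_box r L (fun z => f i z + gamma * violation g A b z).
  apply: (@uniform_bound _ (fun i L => lipschitz_on_box r L (fun z => f i z + gamma * violation g A b z))).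
    by move=> i M M'; apply: lipschitz_on_box_le.
  move=> i; apply: convex_lipschitz; apply: convex_add => //; apply: convex_scal => //.
  exact: violation_convex.
pose K := INR N * (INR m * L' ^ 2) + INR N * (INR nu * L' ^ 2).
have K0 : 0 <= K.
  have pos q : 0 <= INR N * (INR q * L' ^ 2).
    by apply: Rmult_le_pos (pos_INR _) (Rmult_le_pos _ _ (pos_INR _) (pow2_ge_0 _)).
  exact: Rplus_le_le_0_compat.
(* None of these errors involves [w]. The last one pays for replacing the averaged states by the
   state of [i0]. *)
exists (fun k => C * (alpha k * (1 + step_sum alpha k)) ^ 2 + K * alpha k ^ 2
  + 2 * INR N * L * (alpha k * disagreement k)); split.
  apply: summable_add; first apply: summable_add.
  - exact: summable_scal (weighted_step_square_summable h_alpha).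
  - exact: summable_scal (step_square_summable h_alpha).
  - apply: summable_scal; first by repeat apply: Rmult_le_pos => //; [lra | exact: pos_INR].
    apply: summable_mul disagreement_square_summable.
    + by move=> k; left; apply: step_pos h_alpha _.
    + exact: disagreement_ge0.
    + exact: step_square_summable.
move=> w k hw.
have h1 := HC w k hw.
have h2 := multiplier_energy_step a_nondeg a_bal mu_step
  (fun i k l => proj1 (hL' i k) l) gamma k.
have h3 := multiplier_energy_step a_nondeg a_bal lam_step
  (fun i k l => proj2 (hL' i k) l) gamma k.
rewrite /energy; move: h1 h2 h3.
rewrite -/(mean_mu _ k _) -/(mean_lam _ k _).
set P1 := sumI _; set P2 := sumI _; set P3 := sumI _ => h1 h2 h3.
have key : P1 + P2 + P3 <= - (ftot f (x i0 k) + INR N * gamma * violation g A b (x i0 k) - ftot f w)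
    + INR N * L * disagreement k.
  rewrite /P1 /P2 /P3 -!sumI_add.
  (* After the cancellation agent [i] retains only [f i] plus [gamma] times the violation at
     [mean_x i k], a function whose Lipschitz constant is free of multipliers. *)
  apply: Rle_trans (_ : sumI (fun i => f i w - f i (x i0 k) - gamma * violation g A b (x i0 k)
      + L * disagreement k) <= _).
    apply: sumI_le => i.
    have h := HL i _ _ (hbox _ (mean_x_in_X i k)) (hbox _ (x_in_X i0 k)).
    have h' := Rmult_le_compat_l _ _ _ L0 (norm1_mean_x_sub i i0 k).
    rewrite Rabs_minus_sym in h; have := Rle_trans _ _ _ (Rle_abs _) (Rle_trans _ _ _ h h').
    by rewrite /= /violation /ineq_violation /eq_violation /mean_mu /mean_lam; lra.
  by rewrite sumI_add !sumI_sub !sumI_const -/(ftot f w) -/(ftot f (x i0 k)); lra.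
have := Rmult_le_compat_l _ _ _ (Rlt_le _ _ (step_pos h_alpha k)) key.
by rewrite /K; lra.
Qed.

Lemma multiplier_energies_cv gamma w M : (forall k, energy gamma w k <= M) ->
  exists v, Un_cv (fun k => multiplier_energy mu gamma k + multiplier_energy lam gamma k) v.
Proof.
move=> HM; have [L' hL'] := constraints_bounded.
have [v1 h1] := multiplier_energy_cv a_nondeg a_bal a_conn h_alpha mu_step
  (fun i k l => proj1 (hL' i k) l) (gamma := gamma) (M := M) ltac:(
    move=> k; have := HM k; have := primal_energy_ge0 w k;
    have := multiplier_energy_ge0 lam gamma k; rewrite /energy; lra).
have [v2 h2] := multiplier_energy_cv a_nondeg a_bal a_conn h_alpha lam_step
  (fun i k l => proj2 (hL' i k) l) (gamma := gamma) (M := M) ltac:(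
    move=> k; have := HM k; have := primal_energy_ge0 w k;
    have := multiplier_energy_ge0 mu gamma k; rewrite /energy; lra).
by exists (v1 + v2); apply: CV_plus.
Qed.

Lemma x_converges (i0 : 'I_N) : (exists xf, feasible X g A b xf) -> slater X g A b ->
  exists xt, optimal f X g A b xt /\ forall i, Un_cv (fun k => norm1 (vsub (x i k) xt)) 0.
Proof.
move=> hfeas hsl.
have [xs [c [[fs os] c0 hpen]]] := exists_optimal f_convex g_convex X_compact X_convex hfeas hsl.
have N1 : 1 <= INR N by apply: (le_INR 1); apply/leP; apply: leq_ltn_trans (ltn_ord i0).
(* With at least one agent, [INR N * gamma] exceeds the penalty constant by at least 1, as the
   cluster lemma asks. *)
set gamma := c + 1; have g0 : 0 <= gamma by rewrite /gamma; lra.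
have kap : c + 1 <= INR N * gamma by rewrite /gamma; nra.
have [r [sr hstep]] := energy_step i0 g0.
pose D k := ftot f (x i0 k) + INR N * gamma * violation g A b (x i0 k) - ftot f xs.
have D0 k : 0 <= D k.
  have := hpen _ (x_in_X i0 k); have := violation_ge0 g A b (x i0 k); rewrite /D; nra.
have en0 w k : 0 <= energy gamma w k.
  have := primal_energy_ge0 w k; have := multiplier_energy_ge0 mu gamma k.
  by have := multiplier_energy_ge0 lam gamma k; rewrite /energy; lra.
have aD0 k : 0 <= 2 * (alpha k * D k).
  by have := Rmult_le_pos _ _ (Rlt_le _ _ (step_pos h_alpha k)) (D0 k); lra.
have [_ _ sD] := quasi_decreasing_cv (en0 xs) aD0 sr (fun k => hstep xs k fs).
have {}sD : summable (fun k => alpha k * D k).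
  apply: summable_le sD => k; have := aD0 k; lra.
have small := small_terms (step_pos h_alpha) (proj1 (proj2 (proj2 h_alpha))) D0 sD.
(* The condition [j <= k] makes the selected times tend to infinity, as [cv_subseq] requires; they
   need not increase. *)
have pick (j : nat) : {k | (j <= k)%nat /\ D k < / INR j.+1}.
  apply: constructive_indefinite_description; apply: small.
  by apply: Rinv_0_lt_compat; apply: lt_0_INR; apply/ltP.
pose kk j := proj1_sig (pick j).
have kk_ge j : (j <= kk j)%nat by case: (proj2_sig (pick j)).
have [||phi [xt [hphi ft ht hcv]]] := near_minimizers_cluster f_convex g_convex X_compact
    (u := fun j => x i0 (kk j)) hpen kap.
- by move=> j; apply: x_in_X.
- by move=> j; have [_] := proj2_sig (pick j); rewrite -/(kk j) /D; lra.
exists xt; split; first by split=> // z /os; rewrite ht.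
pose sub j := kk (phi j).
have sub_ge j : (j <= sub j)%nat.
  exact: leq_trans (increasing_ge_id hphi j) (kk_ge _).
(* [xt] and [xs] have equal cost, so the gap [D], and with it its nonnegativity, carries over to the
   energy around [xt]. *)
have dec k : energy gamma xt k.+1 <= energy gamma xt k + r k - 2 * (alpha k * D k).
  by rewrite /D -ht; apply: hstep.
have [[E hE] [M HM] _] := quasi_decreasing_cv (en0 xt) aD0 sr dec.
have [v hv] := multiplier_energies_cv HM.
have hP : Un_cv (primal_energy xt) (E - v).
  by apply: Un_cv_ext (CV_minus _ _ _ _ hE hv) => k; rewrite /energy; ring.
have norm_le i k : norm1 (vsub (x i k) xt) <= disagreement k + norm1 (vsub (x i0 k) xt).
  apply: Rle_trans (_ : norm1 (vsub (x i k) (x i0 k)) + norm1 (vsub (x i0 k) xt) <= _).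
    rewrite /norm1 -sumI_add; apply: sumI_le => l; rewrite /vsub.
    by apply: Rle_trans (Rabs_triang _ _); right; congr Rabs; ring.
  by have := norm1_x_sub i i0 k; lra.
(* Agent [i0] approaches [xt] along [sub] and the others follow by consensus; this identifies the
   limit of the whole primal energy. *)
have hsub : Un_cv (fun j => primal_energy xt (sub j)) 0.
  have hd : Un_cv (fun j => disagreement (sub j) + norm1 (vsub (x i0 (sub j)) xt)) 0.
    apply: cv0_add hcv; apply: cv_subseq sub_ge _.
    exact: square_summable_cv0 disagreement_square_summable.
  have := CV_mult _ _ _ _ hd hd; rewrite Rmult_0_l => hd2.
  apply: cv0_le (cv0_scal (INR N) hd2) => j; rewrite Rabs_pos_eq; last exact: primal_energy_ge0.
  rewrite -sumI_const; apply: sumI_le => i; rewrite -vnorm_sqr /= Rmult_1_r.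
  have h := Rle_trans _ _ _ (vnorm_le_norm1 _) (norm_le i (sub j)).
  by apply: Rmult_le_compat => //; apply: vnorm_ge0.
have Ev : E - v = 0 by apply: UL_sequence (cv_subseq sub_ge hP) hsub.
rewrite {}Ev in hP.
move=> i; apply: vnorm_cv0_norm1_cv0 => e e0.
have [K HK] := hP (e ^ 2) ltac:(nra).
exists K => k /HK; rewrite /R_dist !Rminus_0_r.
rewrite Rabs_pos_eq; last exact: primal_energy_ge0.
rewrite Rabs_pos_eq; last exact: vnorm_ge0.
move=> h; have h2 : vnorm (vsub (x i k) xt) ^ 2 < e ^ 2.
  apply: Rle_lt_trans h; rewrite vnorm_sqr.
  by apply: (@sumI_term _ (fun i => dot (vsub (x i k) xt) (vsub (x i k) xt))) => j; apply: dot_ge0.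
by have := vnorm_ge0 (vsub (x i k) xt); nra.
Qed.

(** * Tracking of the optimal value *)

(** Column sums preserve the total under averaging and the increments of [f] telescope from
    [y_init]; [y] at time [k.+1] tracks the cost at time [k]. *)
Lemma sum_y k : sumI (fun i => y i k.+1) = INR N * sumI (fun i => f i (x i k)).
Proof.
elim: k => [|k IH]; rewrite -sumI_scal; first by apply: sumI_ext.
rewrite (@sumI_ext _ _ (fun i => avg a k.+1 (fun j => y j k.+1) i
  + INR N * (f i (x i k.+1) - f i (x i k)))); last by move=> i; rewrite y_step.
by rewrite sumI_add sum_avg // IH !sumI_scal sumI_sub; ring.
Qed.

Lemma f_lipschitz_on_X : exists L, 0 <= L /\ forall i z z', X z -> X z' ->
  Rabs (f i z - f i z') <= L * norm1 (vsub z z').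
Proof.
have [r hbox] := compact_in_box X_compact.
have [L [L0 HL]] : exists L, 0 <= L /\ forall i, lipschitz_on_box r L (f i).
  apply: uniform_bound => [i|i]; last exact: convex_lipschitz.
  by move=> M M'; apply: lipschitz_on_box_le.
by exists L; split=> // i z z' Xz Xz'; apply: HL; apply: hbox.
Qed.

Lemma y_spread : square_summable (fun k => spread (fun i => y i k)).
Proof.
have [L [L0 HL]] := f_lipschitz_on_X.
have [e [e0 se he]] := x_step_close.
(* The value of [y] at time 0 is arbitrary, so the first defect is taken as it is; later ones are
   bounded by the one-step displacement of the states. *)
pose E k := if k is k'.+1 then INR N * L * (INR n * e k' + disagreement k')
  else sumI (fun i => Rabs (y i 1%nat - avg a 0 (fun j => y j 0%nat) i)).
have NL0 : 0 <= INR N * L by apply: Rmult_le_pos => //; apply: pos_INR.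
have E0 k : 0 <= E k.
  case: k => [|k] /=; first by apply: sumI_ge0 => i; apply: Rabs_pos.
  apply: Rmult_le_pos => //; apply: Rplus_le_le_0_compat (disagreement_ge0 k).
  by apply: Rmult_le_pos => //; apply: pos_INR.
apply: (@spread_square_summable _ a a_nondeg a_bal a_conn (fun k i => y i k) E) => //.
  apply: square_summable_shift; apply: square_summable_scal; apply: square_summable_add.
    exact: square_summable_scal.
  exact: disagreement_square_summable.
case=> [|k] i.
  by apply: (@sumI_term _ (fun i => Rabs (y i 1%nat - avg a 0 (fun j => y j 0%nat) i))) => j; apply: Rabs_pos.
rewrite y_step //=.
have -> : forall u v, u + v - u = v by move=> u v; ring.
rewrite Rabs_mult Rabs_pos_eq; last exact: pos_INR.
rewrite Rmult_assoc; apply: Rmult_le_compat_l; first exact: pos_INR.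
apply: Rle_trans (HL i _ _ (x_in_X i k.+1) (x_in_X i k)) _.
apply: Rmult_le_compat_l => //.
apply: Rle_trans (_ : norm1 (vsub (x i k.+1) (mean_x i k)) + norm1 (vsub (mean_x i k) (x i k)) <= _).
  rewrite /norm1 -sumI_add; apply: sumI_le => l; rewrite /vsub.
  by apply: Rle_trans (Rabs_triang _ _); right; congr Rabs; ring.
apply: Rplus_le_compat (norm1_mean_x_sub i i k).
by rewrite -sumI_const; apply: sumI_le => l; apply: he.
Qed.

Lemma y_converges xt i : X xt -> (forall j, Un_cv (fun k => norm1 (vsub (x j k) xt)) 0) ->
  Un_cv (fun k => y i k - ftot f xt) 0.
Proof.
move=> Xt hx; have [L [L0 HL]] := f_lipschitz_on_X.
have Npos := INR_ord_gt0 i.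
apply: cv_shift.
apply: (@cv0_le _ (fun k => spread (fun j => y j k.+1) + L * sumI (fun j => norm1 (vsub (x j k) xt)))); last first.
  apply: cv0_add; last by apply: cv0_scal; apply: cv0_sumI.
  exact: square_summable_cv0 (square_summable_unshift y_spread).
move=> k.
have -> : y i k.+1 - ftot f xt =
    (y i k.+1 - / INR N * sumI (fun j => y j k.+1)) + (sumI (fun j => f j (x j k)) - ftot f xt).
  by rewrite sum_y; field; lra.
apply: Rle_trans (Rabs_triang _ _) _; apply: Rplus_le_compat.
  exact: (Rabs_sub_mean (fun j => y j k.+1)).
rewrite -sumI_sub -sumI_scal; apply: Rle_trans (sumI_Rabs _) _; apply: sumI_le => j.
by apply: HL => //; apply: x_in_X.
Qed.

End Algorithm.

Theorem mainTheorem12 (n N m nu : nat)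
  (f : 'I_N -> vec n -> R) (X : vec n -> Prop)
  (g : 'I_m -> vec n -> R) (A : 'I_nu -> vec n) (b : 'I_nu -> R)
  (a : nat -> 'I_N -> 'I_N -> R) (alpha : nat -> R)
  (x : 'I_N -> nat -> vec n) (y : 'I_N -> nat -> R)
  (mu : 'I_N -> nat -> 'I_m -> R) (lam : 'I_N -> nat -> 'I_nu -> R) :
  (forall i, convex_fun (f i)) ->
  (exists x0, X x0) -> compact_set X -> convex_set X ->
  (forall l, convex_fun (g l)) ->
  (exists xf, feasible X g A b xf) ->
  slater X g A b ->
  non_degenerate a -> balanced a -> periodic_strong_conn a ->
  step_size alpha ->
  DPPDS f X g A b a alpha x y mu lam ->
  exists xt, optimal f X g A b xt /\
    (forall i, Un_cv (fun k => vnorm (vsub (x i k) xt)) 0) /\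
    (forall p, opt_value f X g A b p ->
       forall i, Un_cv (fun k => Rabs (y i k - p)) 0).

Proof.
move=> f_cvx _ X_cpt X_cvx g_cvx feas slat nondeg bal conn h_alpha.
move=> [x0 [mu0 [lam0 [y1 [[df [dg [dh [hdf [hdg [hdh x_step]]]]]] [mu_step [lam_step y_step]]]]]]].
case: (classic (exists i0 : 'I_N, True)) => [[i0 _]|noagent]; last first.
  (* With no agents the cost is an empty sum, so every feasible point is optimal and the limits are
     vacuous. *)
  have [xf hxf] := feas; exists xf; split; last by split=> [i|p _ i]; case: noagent; exists i.
  by split=> // z _; right; apply: sumI_ext => i; case: noagent; exists i.
have [xt [ot hx]] := x_converges f_cvx g_cvx X_cpt X_cvx nondeg bal conn h_alpha
  x0 mu0 lam0 hdf hdg hdh x_step mu_step lam_step i0 feas slat.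
exists xt; split=> //; split=> [i|p [plb pglb] i].
  exact: norm1_cv0_vnorm_cv0.
have [fxt oxt] := ot.
have -> : p = ftot f xt.
  apply: Rle_antisym; first by apply: plb; exists xt.
  by apply: pglb => v [z [/oxt hz ->]].
have := y_converges f_cvx g_cvx X_cpt X_cvx nondeg bal conn h_alpha
  x0 mu0 lam0 y1 hdf hdg hdh x_step mu_step lam_step y_step i (proj1 fxt) hx.
by move=> /cv_cvabs; rewrite Rabs_R0.
Qed.
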